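(* Let $f\colon\mathcal{O}_1\to\mathcal{O}_2$ be an orbifold embedding and let $\mathcal{P}$ be a suborbifold of $\mathcal{O}_1$. Then $f(\mathcal{P})$ is a suborbifold of $\mathcal{O}_2$ of dimension $\dim\mathcal{P}$. If $\mathcal{P}$ is an embedded suborbifold of $\mathcal{O}_1$, then $f(\mathcal{P})$ is an embedded suborbifold of $\mathcal{O}_2$.
   Context: Manifolds are Hausdorff, second countable, smooth, without boundary and of constant finite dimension (not necessarily connected). ''Submanifold'' means embedded submanifold. $H$-submanifolds: for a Lie group $G$ (possibly finite), a $G$-manifold is a manifold with a smooth left $G$-action. If $H\subset G$ is a closed subgroup and $M$ is a $G$-manifold, an $H$-submanifold of $M$ is a submanifold $N\subset M$ with $N\cap Gx=Hx$ for every $x\in N$. Orbifolds: let $X$ be a second countable Hausdorff space. An $n$-dimensional orbifold chart on $X$ is a quadruple $(U,\widetilde{U}/\Gamma,\pi)$ where $U\subset X$ is open, $\Gamma$ is a finite group, $\widetilde{U}$ is a connected $n$-dimensional manifold with a smooth effective $\Gamma$-action, and $\pi\colon\widetilde{U}\to U$ is a continuous $\Gamma$-invariant map inducing a homeomorphism $\widetilde{U}/\Gamma\to U$. An injection from a chart $(V,\widetilde{V}/\Delta,\phi)$ to a chart $(U,\widetilde{U}/\Gamma,\pi)$ with $V\subset U$ is a smooth embedding $\lambda\colon\widetilde{V}\to\widetilde{U}$ with $\pi\circ\lambda=\phi$. Two charts $(U_i,\widetilde{U}_i/\Gamma_i,\pi_i)$, $i=1,2$, are compatible in $p$ if there is a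 chart $(V,\widetilde{V}/\Delta,\phi)$ with $p\in V\subset U_1\cap U_2$ and injections from it into both charts. An $n$-dimensional orbifold atlas on $X$ is a collection of $n$-dimensional orbifold charts whose sets $U_\alpha$ cover $X$ and such that any two of them are compatible in every point of $U_\alpha\cap U_\beta$; every atlas is contained in a unique maximal atlas. An (effective) orbifold is a space $X$ together with a maximal orbifold atlas; a chart of (or on) the orbifold is an element of this maximal atlas. The orbifold and its underlying space are denoted by the same symbol. Suborbifolds: a subset $\mathcal{P}\subset\mathcal{O}$ is a $k$-dimensional suborbifold ($0\le k\le\dim\mathcal{O}$) if for every $p\in\mathcal{P}$ there are a chart $(U,\widetilde{U}/\Gamma,\pi)$ of $\mathcal{O}$, a subgroup $\Delta\subset\Gamma$ and a $k$-dimensional $\Delta$-submanifold $\widetilde{V}\subset\widetilde{U}$, connected and closed in $\widetilde{U}$, such that $\pi(\widetilde{V})$ is an open neighborhood of $p$ in $\mathcal{P}$. It is an embedded $k$-dimensional suborbifold if these data can be chosen, for every $p\in\mathcal{P}$, such that in addition $\Delta$ acts effectively on $\widetilde{V}$. Smooth maps: a continuous map $f\colon\mathcal{O}_1\to\mathcal{O}_2$ between orbifolds is smooth if for every $p\in\mathcal{O}_1$ there are charts $(U_i,\widetilde{U}_i/\Gamma_i,\pi_i)$ of $\mathcal{O}_i$, $i=1,2$, around $p$ and $f(p)$, respectively, a smooth map $\widetilde{f}\colon\widetilde{U}_1\to\widetilde{U}_2$ and a homomorphism $\Theta\colon\Gamma_1\to\Gamma_2$ such that $f\circ\pi_1=\pi_2\circ\widetilde{f}$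 and $\widetilde{f}(\gamma x)=\Theta(\gamma)\widetilde{f}(x)$ for all $\gamma\in\Gamma_1$, $x\in\widetilde{U}_1$. The rank of $f$ in $p$ is the rank of any such lift $\widetilde{f}$ in some $\widetilde{p}\in\pi_1^{-1}(p)$ (this is well-defined). A smooth map $f\colon\mathcal{O}_1\to\mathcal{O}_2$ is an immersion if it has constant rank $\dim\mathcal{O}_1$, and an (orbifold) embedding if it is an immersion and a topological embedding between the underlying spaces. *)

(* Defs.v *)
From HB Require Import structures.
From mathcomp Require Import all_boot all_order all_algebra all_fingroup.
From mathcomp Require Import generic_quotient.
From mathcomp Require Import all_classical all_reals all_analysis.

Set Implicit Arguments.
Unset Strict Implicit.
Unset Printing Implicit Defensive.

Import Order.TTheory GRing.Theory Num.Theory.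
Import numFieldNormedType.Exports.

Local Open Scope classical_set_scope.
Local Open Scope ring_scope.
Local Open Scope quotient_scope.

Definition topological_embedding (S T : topologicalType) (f : S -> T) :=
  [/\ injective f, continuous f &
      forall A : set S, open A -> exists2 B : set T, open B & A = f @^-1` B].

Section Smoothness.
Context {R : realType} {m n : nat}.

(* Class C^k on an open set [U]; the values of [f] off [U] play no role. *)
Fixpoint Ck_on (k : nat) (U : set 'rV[R]_m) (f : 'rV[R]_m -> 'rV[R]_n) : Prop :=
  match k with
  | 0 => {within U, continuous f}
  | k'.+1 => (forall x, U x -> differentiable f x) /\
             (forall v, Ck_on k' U ('D_v f))
  end.

Definition smooth_on (U : set 'rV[R]_m) (f : 'rV[R]_m -> 'rV[R]_n) :=
  forall k, Ck_on k U f.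

End Smoothness.

(* A homeomorphism from the open set [cdom] onto an open subset of R^n;
   [cfun] and its inverse [cinv] carry junk values elsewhere. *)
Record mchart (R : realType) (n : nat) (M : topologicalType) := MChart {
  cdom : set M;
  cfun :> M -> 'rV[R]_n;
  cinv : 'rV[R]_n -> M;
  cdom_open : open cdom;
  cimg_open : open (cfun @` cdom);
  cfunK : forall x, cdom x -> cinv (cfun x) = x;
  cfun_continuous : {within cdom, continuous cfun};
  cinv_continuous : {within cfun @` cdom, continuous cinv}
}.

(* The smooth structure is presented by an atlas that need not be maximal:
   it generates a unique maximal one, and smoothness and rank of maps, defined
   below through all (resp. some) charts of the atlas, depend only on the latter.
   The manifold may be empty or disconnected. *)
Record manifold (R : realType) (n : nat) := Manifold {
  mspace :> topologicalType;
  mspace_hausdorff : hausdorff_space mspace;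
  mspace_second_countable : @second_countable mspace;
  matlas : set (mchart R n mspace);
  matlas_cover : forall x, exists2 c, matlas c & cdom c x;
  matlas_compat : forall c d, matlas c -> matlas d ->
    smooth_on (c @` (cdom c `&` cdom d)) (d \o cinv c)
}.

Section ManifoldMaps.
Context {R : realType} {m n : nat} {M : manifold R m} {N : manifold R n}.
Implicit Type f : M -> N.

Definition chart_rep f (c : mchart R m M) (d : mchart R n N) :
    'rV[R]_m -> 'rV[R]_n :=
  d \o f \o cinv c.

Definition smooth_map f :=
  continuous f /\
  forall c d, matlas c -> matlas d ->
    smooth_on (c @` (cdom c `&` f @^-1` cdom d)) (chart_rep f c d).

Definition has_rank f (x : M) (r : nat) :=
  exists c d, [/\ matlas c, matlas d, cdom c x, cdom d (f x) &
                  \rank (jacobian (chart_rep f c d) (c x)) = r].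

Definition smooth_embedding f :=
  [/\ smooth_map f, forall x, has_rank f x m & topological_embedding f].

End ManifoldMaps.

(* [N] is an embedded submanifold when, with the subspace topology, it carries a
   smooth structure making its inclusion a smooth embedding.  Here the subset
   so structured is given as the image of [i : S -> M]. *)
Definition submanifold (R : realType) (n : nat) (M : manifold R n) (k : nat)
    (N : set M) :=
  exists (S : manifold R k) (i : S -> M), smooth_embedding i /\ range i = N.

(* Left actions, unlike the (right) actions of the library file action.v. *)
Record gmanifold (R : realType) (n : nat) (G : finGroupType) := GManifold {
  gspace :> manifold R n;
  gact : G -> gspace -> gspace;
  gact1 : forall x, gact 1%g x = x;
  gactM : forall g h x, gact (g * h)%g x = gact g (gact h x);
  gact_smooth : forall g, smooth_map (gact g)
}.
Arguments gact {R n G M} : rename.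

Section GManifolds.
Context {R : realType} {n : nat} {G : finGroupType} {M : gmanifold R n G}.

Definition gorbit (H : {set G}) (x : M) : set M :=
  [set gact h x | h in [set h | h \in H]].

Definition effective_on (H : {set G}) (N : set M) :=
  forall h, h \in H -> (forall x, N x -> gact h x = x) -> h = 1%g.

Definition Hsubmanifold (H : {group G}) (k : nat) (N : set M) :=
  submanifold k N /\ forall x, N x -> N `&` gorbit [set: G] x = gorbit H x.

Definition gorbit_rel : rel M := fun x y => `[< gorbit [set: G] x y >].

Lemma gorbit_rel_refl : reflexive gorbit_rel.
Proof. by move=> x; apply/asboolP; exists 1%g; rewrite ?gact1 //= inE. Qed.

Lemma gorbit_relW x y : gorbit_rel x y -> gorbit_rel y x.
Proof.
move=> /asboolP[g _ <-]; apply/asboolP; exists g^-1%g; first by rewrite /= inE.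
by rewrite -gactM mulVg gact1.
Qed.

Lemma gorbit_rel_sym : symmetric gorbit_rel.
Proof. by move=> x y; apply/idP/idP; apply: gorbit_relW. Qed.

Lemma gorbit_rel_trans : transitive gorbit_rel.
Proof.
move=> y x z /asboolP[g _ <-] /asboolP[h _ <-]; apply/asboolP.
by exists (h * g)%g; rewrite ?gactM //= inE.
Qed.

Definition gorbit_equiv : equiv_rel M :=
  EquivRel gorbit_rel gorbit_rel_refl gorbit_rel_sym gorbit_rel_trans.

End GManifolds.

Definition orbit_space (R : realType) (n : nat) (G : finGroupType)
    (M : gmanifold R n G) : topologicalType :=
  quotient_topology {eq_quot (@gorbit_equiv R n G M)}.

Definition orbit_map (R : realType) (n : nat) (G : finGroupType)
    (M : gmanifold R n G) (X : Type) (f : M -> X) (q : orbit_space M) : X :=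
  f (repr (q : quotient_topology {eq_quot (@gorbit_equiv R n G M)})).

Record orbichart (R : realType) (n : nat) (X : topologicalType) := OrbiChart {
  odom : set X;
  ogroup : finGroupType;
  ocover : gmanifold R n ogroup;
  oproj :> ocover -> X;
  odom_open : open odom;
  ocover_connected : connected [set: ocover];
  ocover_effective : effective_on [set: ogroup] [set: ocover];
  oproj_continuous : continuous oproj;
  oproj_invariant : forall (g : ogroup) x, oproj (gact g x) = oproj x;
  (* the induced map is a homeomorphism onto [odom] *)
  oproj_range : range oproj = odom;
  oproj_homeo : topological_embedding (orbit_map oproj)
}.

(* Sets of charts are plain predicates: [orbichart] lives in a universe too large
   for [set]. *)
Section OrbifoldAtlases.
Context {R : realType} {n : nat} {X : topologicalType}.
Implicit Types (b c d : orbichart R n X) (A B : orbichart R n X -> Prop).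

Definition injection b c (l : ocover b -> ocover c) :=
  [/\ odom b `<=` odom c, smooth_embedding l & forall x, c (l x) = b x].

Definition compatible_in c d (p : X) :=
  exists b, [/\ odom b p, odom b `<=` odom c `&` odom d,
                exists l, @injection b c l & exists l, @injection b d l].

Definition orbifold_atlas A :=
  (forall p, exists2 c, A c & odom c p) /\
  (forall c d, A c -> A d ->
     forall p, odom c p -> odom d p -> compatible_in c d p).

Definition maximal_orbifold_atlas A :=
  orbifold_atlas A /\ forall B, orbifold_atlas B -> (forall c, A c -> B c) ->
    forall c, B c -> A c.

End OrbifoldAtlases.

Record orbifold (R : realType) (n : nat) := Orbifold {
  ospace :> topologicalType;
  ospace_hausdorff : hausdorff_space ospace;
  ospace_second_countable : @second_countable ospace;
  oatlas : orbichart R n ospace -> Prop;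
  oatlas_maximal : maximal_orbifold_atlas oatlas
}.

Section Suborbifolds.
Context {R : realType} {n : nat} {O : orbifold R n}.

Definition suborbifold_chart (k : nat) (P : set O) (p : O)
    (c : orbichart R n O) (D : {group ogroup c}) (V : set (ocover c)) :=
  [/\ oatlas c, Hsubmanifold D k V, connected V, closed V &
      (c @` V) p /\ exists2 W : set O, open W & c @` V = P `&` W].

Definition suborbifold (k : nat) (P : set O) :=
  (k <= n)%N /\
  forall p, P p -> exists c (D : {group ogroup c}) V,
    suborbifold_chart k P p D V.

Definition embedded_suborbifold (k : nat) (P : set O) :=
  (k <= n)%N /\
  forall p, P p -> exists c (D : {group ogroup c}) V,
    suborbifold_chart k P p D V /\ effective_on D V.

End Suborbifolds.

Section OrbifoldMaps.
Context {R : realType} {n1 n2 : nat}.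
Context {O1 : orbifold R n1} {O2 : orbifold R n2}.
Implicit Type f : O1 -> O2.

Definition lift_at f (p : O1) (c : orbichart R n1 O1) (d : orbichart R n2 O2)
    (F : ocover c -> ocover d) (T : {morphism [set: ogroup c] >-> ogroup d}) :=
  [/\ oatlas c /\ oatlas d, odom c p /\ odom d (f p), smooth_map F,
      forall x, f (c x) = d (F x) &
      forall (g : ogroup c) x, F (gact g x) = gact (T g) (F x)].

Definition orbi_smooth f :=
  continuous f /\ forall p, exists c d F T, @lift_at f p c d F T.

Definition orbi_has_rank f (p : O1) (r : nat) :=
  exists c d F T, @lift_at f p c d F T /\
    exists2 x, c x = p & has_rank F x r.

(* The rank of a map into an [n2]-dimensional orbifold is at most [n2], so
   constant rank [n1] presupposes [n1 <= n2]; this clause is automatic unless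
   [O1] is empty. *)
Definition orbi_immersion f :=
  [/\ (n1 <= n2)%N, orbi_smooth f & forall p, orbi_has_rank f p n1].

Definition orbi_embedding f := orbi_immersion f /\ topological_embedding f.

End OrbifoldMaps.

(* Main.v *)
(** Let [t] be the transition map from the chart carrying the local model [V] of [P] to a
    chart on which [f] has an equivariant lift [F] of full rank, and let [s0 = F o t].
    Locally [s0] is an embedding, so [s0] maps a small piece of [V] onto a submanifold.
    By compactness this piece is closed in a small slice [W] of the target chart around
    [s0 v], and the restriction of the target chart to [W] again belongs to the maximal
    atlas.  A stabilizer element [g] of [v] is carried by [t] to a group element: a local
    diffeomorphism over the identity of the orbifold agrees, near each point, with a group
    element, because the sets where it does so are closed and finitely many, and two group
    elements with the same 1-jet at a point coincide near it.  Applying the homomorphism of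
    the lift gives the group acting on the image.  Injectivity of [f] shows that points of
    the image in one orbit come from points of [V] in one orbit. *)

(* A suborbifold chart asks for a set that is connected, closed in the cover, and met by each orbit
   of the full group exactly in an orbit of the subgroup, whereas the image of [V] is under control
   only near one point. The compact neighbourhood [K] of [v] answers the demand for closedness: the
   image of [K] minus its interior is closed and misses [s0 v], so a slice [W] avoiding it meets the
   image of [K] only in images of interior points. Inside [W] the image of the part of [V] in [K] is
   therefore both closed and parametrized by an open set, and passing to a connected component keeps
   both properties. The orbit condition is the reason to take [K] inside a slice too: a group
   element carrying a point of [K] into [K] then fixes [v], and only such elements can be
   transported to the target. Group elements are compared through first derivatives at a point, in
   place of a linearization of the action by an invariant metric. *)
Require Import Defs.
From HB Require Import structures.
From mathcomp Require Import all_boot all_order all_algebra all_fingroup.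
From mathcomp Require Import generic_quotient.
From mathcomp Require Import all_classical all_reals all_analysis.
From mathcomp Require Import ring lra.
(* After [all_fingroup], so that [gact] denotes the action of Defs. *)
Import Defs.

Set Implicit Arguments.
Unset Strict Implicit.
Unset Printing Implicit Defensive.

Import Order.TTheory GRing.Theory Num.Theory.
Import numFieldNormedType.Exports.

Local Open Scope classical_set_scope.
Local Open Scope ring_scope.

(** * Functions of class C^k on Euclidean spaces *)

Section DiffEps.
Context {R : realType} {V W : normedModType R}.

(** One estimate yields both differentiability and the value of the differential, so later Jacobians
    are found by naming the candidate. *)
Lemma eps_differentiable (f : V -> W) (L : {linear V -> W}) (x : V) :
  continuous L ->
  (forall e : R, 0 < e -> exists2 d, 0 < d &
     forall h : V, `|h| < d -> `|f (h + x) - f x - L h| <= e * `|h|) ->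
  differentiable f x /\ 'd f x = L :> (_ -> _).
Proof.
move=> cL H.
have E : f \o shift x = cst (f x) + L +o_ 0 id.
  apply: (iffRL (eqaddoP _ _ _ _)) => e e0.
  have [d d0 {}H] := H e e0.
  apply/nbhs_normP; exists d => //= h; rewrite /ball_ /= sub0r normrN => /H.
  by rewrite !fctE /= opprD addrA.
have dE := diff_unique cL E; split=> //.
by apply/diff_locallyP; rewrite dE; split.
Qed.

Lemma diff_eps (f : V -> W) (x : V) : differentiable f x ->
  forall e : R, 0 < e -> exists2 d, 0 < d &
     forall h : V, `|h| < d -> `|f (h + x) - f x - 'd f x h| <= e * `|h|.
Proof.
move=> /diff_locallyP[_ /(iffLR (eqaddoP _ _ _ _)) H] e e0.
have /nbhs_normP[d /= d0 {}H] := H e e0; exists d => // h hd.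
by have := H h; rewrite /ball_ /= sub0r normrN !fctE /= opprD addrA; apply.
Qed.

Lemma near_eq_differentiable (f g : V -> W) (x : V) :
  (\forall y \near x, f y = g y) -> differentiable f x -> differentiable g x.
Proof.
move=> fg df.
have fgx := nbhs_singleton fg.
suff [] : differentiable g x /\ 'd g x = 'd f x :> (_ -> _) by [].
apply: eps_differentiable => [|e e0]; first exact: diff_continuous.
have [d d0 H] := diff_eps df e0.
move: fg => /nbhs_normP[d' /= d'0 fg].
exists (Num.min d d'); first by rewrite lt_min d0.
move=> h; rewrite lt_min => /andP[/H hd hd'].
by rewrite -fg -?fgx//= opprD addrCA subrr addr0 normrN.
Qed.

End DiffEps.

Section Ck.
Context {R : realType} {m : nat}.

(* [Ck_on] with an arbitrary codomain, so that coordinates are functions to [R]. *)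
Fixpoint Ckg (W : normedModType R) (k : nat) (U : set 'rV[R]_m)
    (f : 'rV[R]_m -> W) : Prop :=
  match k with
  | 0 => {within U, continuous f}
  | k'.+1 => (forall x, U x -> differentiable f x) /\
             (forall v, Ckg k' U ('D_v f))
  end.

Lemma Ckg0P (W : normedModType R) (U : set 'rV[R]_m) (f : 'rV[R]_m -> W) : open U ->
  {within U, continuous f} <-> forall x, U x -> {for x, continuous f}.
Proof.
move=> oU; rewrite continuous_open_subspace//; split=> H x.
  by move=> Ux; apply: H; rewrite inE.
by rewrite inE => /H.
Qed.

Lemma eq_on_open_derive (W : normedModType R) (U : set 'rV[R]_m) (f g : 'rV[R]_m -> W) v x :
  open U -> (forall y, U y -> f y = g y) -> U x -> 'D_v f x = 'D_v g x.
Proof.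
move=> oU fg Ux; apply: near_eq_derive.
by near=> y; apply: fg; near: y; apply: open_nbhs_nbhs.
Unshelve. all: by end_near. Qed.

Lemma Ckg_ext (W : normedModType R) k (U : set 'rV[R]_m) (f g : 'rV[R]_m -> W) : open U ->
  (forall y, U y -> f y = g y) -> Ckg k U f -> Ckg k U g.
Proof.
move=> oU; elim: k f g => [|k IH] f g fg /=.
  by apply: subspace_eq_continuous => x /set_mem /fg.
move=> [df cf]; split.
  move=> x Ux; apply: near_eq_differentiable (df _ Ux).
  by apply: filterS (open_nbhs_nbhs (conj oU Ux)) => y /fg.
by move=> v; apply: IH (cf v) => x Ux; apply: eq_on_open_derive Ux.
Qed.

Lemma Ckg_sub (W : normedModType R) k (U V : set 'rV[R]_m) (f : 'rV[R]_m -> W) :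
  V `<=` U -> Ckg k U f -> Ckg k V f.
Proof.
move=> VU; elim: k f => [|k IH] f /=; first exact: continuous_subspaceW.
by move=> [df cf]; split => [x /VU /df|v] //; exact: IH.
Qed.

Lemma Ckg_local (W : normedModType R) k (U : set 'rV[R]_m) (f : 'rV[R]_m -> W) : open U ->
  (forall x, U x -> exists V, [/\ open V, V x & Ckg k V f]) -> Ckg k U f.
Proof.
move=> oU; elim: k f => [|k IH] f /= H.
  by apply/Ckg0P => // x /H[V [oV Vx /Ckg0P]]; apply.
split=> [x /H[V [oV Vx [df _]]]|v]; first exact: df.
by apply: IH => x /H[V [oV Vx [_ cf]]]; exists V.
Qed.

Lemma Ckg_weaken (W : normedModType R) k (U : set 'rV[R]_m) (f : 'rV[R]_m -> W) : open U ->
  Ckg k.+1 U f -> Ckg k U f.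
Proof.
move=> oU; elim: k f => [|k IH] f [df cf].
  by apply/Ckg0P => // x /df; apply: differentiable_continuous.
by split => // v; exact: IH.
Qed.

Lemma Ckg_cst (W : normedModType R) k (U : set 'rV[R]_m) (w : W) : Ckg k U (cst w).
Proof.
elim: k w => [|k IH] w /=; first by apply: continuous_subspaceT; exact: cst_continuous.
split=> [x _|v]; first exact: differentiable_cst.
have -> : 'D_v (cst w) = cst (0 : W) by apply/funext => x; rewrite derive_cst.
exact: IH.
Qed.

Lemma Ckg_lin (W : normedModType R) k (U : set 'rV[R]_m) (L : {linear 'rV[R]_m -> W}) :
  open U -> continuous L -> Ckg k U L.
Proof.
move=> oU cL; case: k => [|k] /=; first exact: continuous_subspaceT.
have dL x : differentiable L x by exact: linear_differentiable.
split=> // v.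
have -> : 'D_v L = cst (L v) by apply/funext => x; rewrite deriveE// diff_lin.
exact: Ckg_cst.
Qed.

Lemma Ckg_add (W : normedModType R) k (U : set 'rV[R]_m) (f g : 'rV[R]_m -> W) : open U ->
  Ckg k U f -> Ckg k U g -> Ckg k U (f + g).
Proof.
move=> oU; elim: k f g => [|k IH] f g /=.
  move=> /Ckg0P-/(_ oU) cf /Ckg0P-/(_ oU) cg; apply/Ckg0P => // x Ux.
  by apply: continuousD; [exact: cf | exact: cg].
move=> [df cf] [dg cg]; split=> [x Ux|v].
  by apply: differentiableD; [exact: df|exact: dg].
apply: Ckg_ext (IH _ _ (cf v) (cg v)) => // x Ux.
by rewrite deriveD//; apply: diff_derivable; [exact: df|exact: dg].
Qed.

Lemma Ckg_mul k (U : set 'rV[R]_m) (f g : 'rV[R]_m -> R) : open U ->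
  Ckg k U f -> Ckg k U g -> Ckg k U (f * g).
Proof.
move=> oU; elim: k f g => [|k IH] f g.
  move=> /Ckg0P-/(_ oU) cf /Ckg0P-/(_ oU) cg; apply/Ckg0P => // x Ux.
  by apply: continuousM; [exact: cf | exact: cg].
(* The product rule also contains [f] and [g] undifferentiated, so the induction hypothesis needs
   them at order [k]. *)
move=> Cf Cg; have Cf' := Ckg_weaken oU Cf; have Cg' := Ckg_weaken oU Cg.
case: Cf Cg => [df cf] [dg cg]; split=> [x Ux|v].
  by apply: differentiableM; [exact: df|exact: dg].
apply: Ckg_ext (Ckg_add oU (IH _ _ Cf' (cg v)) (IH _ _ Cg' (cf v))) => // x Ux.
by rewrite deriveM//; apply: diff_derivable; [exact: df|exact: dg].
Qed.

Lemma Ckg_inv k (U : set 'rV[R]_m) (f : 'rV[R]_m -> R) : open U ->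
  (forall x, U x -> f x != 0) -> Ckg k U f -> Ckg k U (fun x => (f x)^-1).
Proof.
move=> oU f0; elim: k f f0 => [|k IH] f f0.
  move=> /Ckg0P-/(_ oU) cf; apply/Ckg0P => // x Ux.
  by apply: continuousV; [exact: f0 | exact: cf].
move=> Cf; have /(IH _ f0) Cf' := Ckg_weaken oU Cf.
case: Cf => [df cf]; split=> [x Ux|v].
  by apply: differentiableV; [exact: df|exact: f0].
(* The derivative of [1 / f] is [-1] times the square of [1 / f] times that of [f], and [1 / f] has
   class [k] by induction. *)
have := Ckg_mul oU (Ckg_cst k U (-1 : R)) (Ckg_mul oU (Ckg_mul oU Cf' Cf') (cf v)).
apply: Ckg_ext => // x Ux.
rewrite deriveV//; [|exact: f0|by apply: diff_derivable; exact: df].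
by rewrite /= !fctE /GRing.scale /= mulN1r expr2 invfM mulNr.
Qed.

Lemma Ckg_sum (W : normedModType R) k (U : set 'rV[R]_m) (I : Type) (r : seq I) (P : pred I)
    (F : I -> 'rV[R]_m -> W) : open U ->
  (forall i, P i -> Ckg k U (F i)) -> Ckg k U (fun x => \sum_(i <- r | P i) F i x).
Proof.
move=> oU H; rewrite -fct_sumE.
elim/big_ind: _ => //; first exact: (Ckg_cst k U (0 : W)).
by move=> f g; exact: Ckg_add.
Qed.

Lemma Ckg_prod k (U : set 'rV[R]_m) (I : Type) (r : seq I) (P : pred I)
    (F : I -> 'rV[R]_m -> R) : open U ->
  (forall i, P i -> Ckg k U (F i)) -> Ckg k U (fun x => \prod_(i <- r | P i) F i x).
Proof.
move=> oU H; rewrite -fct_prodE.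
elim/big_ind: _ => //; first exact: (Ckg_cst k U (1 : R)).
by move=> f g; exact: Ckg_mul.
Qed.

End Ck.

Lemma nbhs_forall (T : topologicalType) (I : finType) (f : I -> set T) (x : T) :
  (forall i, nbhs x (f i)) -> nbhs x (fun a => forall i, f i a).
Proof. by move=> H; exact: (@filter_forall T I f (nbhs x)). Qed.

Section Coord.
Context {R : realType}.

Lemma Ck_onE m n k (U : set 'rV[R]_m) (f : 'rV[R]_m -> 'rV[R]_n) :
  Ck_on k U f <-> Ckg k U f.
Proof. by elim: k f => [|k IH] f //=; split=> -[df cf]; split=> // v; apply/IH. Qed.

Lemma linear_rV_continuous n (W : normedModType R) (L : {linear 'rV[R]_n -> W}) : continuous L.
Proof.
have -> : (L : _ -> _) = fun v => \sum_j v 0 j *: L (delta_mx 0 j).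
  apply/funext => v; rewrite {1}[v]row_sum_delta linear_sum.
  by apply: eq_bigr => j _; rewrite linearZ.
move=> v; rewrite -fct_sumE.
elim/big_ind: _ => [|f g cf cg|j _]; first exact: cst_continuous.
  by apply: continuousD.
by apply: (@continuousZr_tmp R _ _ (fun z : 'rV[R]_n => z 0 j)); exact: coord_continuous.
Qed.

Lemma ler_coord_norm n (v : 'rV[R]_n) j : `|v 0 j| <= `|v|.
Proof. by rewrite [leRHS]/Num.norm /= mx_normrE; apply/bigmax_geP; right; exists (0, j). Qed.

Lemma norm_coord_le n (v : 'rV[R]_n) c : 0 <= c -> (forall j, `|v 0 j| <= c) -> `|v| <= c.
Proof.
move=> c0 H; rewrite [leLHS]/Num.norm /= mx_normrE; apply/bigmax_leP; split=> // -[i j] _ /=.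
by rewrite ord1.
Qed.

Lemma differentiable_coordP m n (f : 'rV[R]_m -> 'rV[R]_n) x :
  differentiable f x <-> forall j, differentiable (fun y => f y 0 j) x.
Proof.
split=> [df j|H].
  exact: (differentiable_comp df (differentiable_coord _ _ _)).
have -> : f = \sum_(j < n) (fun y => f y 0 j *: (delta_mx 0 j : 'rV[R]_n)).
  by apply/funext => y; rewrite fct_sumE [LHS]row_sum_delta.
by apply: differentiable_sum => j; apply: differentiableZl.
Qed.

Lemma derive_coord m n (f : 'rV[R]_m -> 'rV[R]_n) x v j :
  differentiable f x -> 'D_v (fun y => f y 0 j) x = 'D_v f x 0 j.
Proof.
move=> df.
have dfj : differentiable (fun y => f y 0 j) x by exact: ((differentiable_coordP f x).1 df j).
rewrite !deriveE//.
pose c : 'rV[R]_n -> R := fun N => N 0 j.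
have lc : linear c by move=> a u w; rewrite /c !mxE.
pose cL : {linear 'rV[R]_n -> R} := HB.pack c (GRing.isLinear.Build _ _ _ _ c lc).
have cc : continuous cL by exact: coord_continuous.
have dc : differentiable cL (f x) by exact: linear_differentiable.
have -> : (fun y => f y 0 j) = cL \o f by [].
by rewrite (diff_comp df dc) /= (diff_lin _ cc).
Qed.

Lemma Ckg_scalel m (W : normedModType R) (w : W) k (U : set 'rV[R]_m) (g : 'rV[R]_m -> R) :
  open U -> Ckg k U g -> Ckg k U (fun y => g y *: w).
Proof.
move=> oU; elim: k g => [|k IH] g.
  move=> /Ckg0P-/(_ oU) cf; apply/Ckg0P => // x /cf fx.
  exact: continuousZr_tmp.
move=> [df cf]; split=> [x /df|v]; first exact: differentiableZl.
apply: Ckg_ext (IH _ (cf v)) => // x Ux.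
have dg := df _ Ux.
by rewrite !deriveE ?diffZl//; exact: differentiableZl.
Qed.

Lemma Ckg_coordP m n k (U : set 'rV[R]_m) (f : 'rV[R]_m -> 'rV[R]_n) : open U ->
  Ckg k U f <-> forall j, Ckg k U (fun y => f y 0 j).
Proof.
move=> oU; split.
  elim: k f => [|k IH] f.
    move=> /Ckg0P-/(_ oU) cf j; apply/Ckg0P => // x /cf fx.
    exact: (continuous_comp fx (@coord_continuous _ _ _ _ _ _)).
  move=> [df cf] j; split=> [x /df dfx|v]; first exact: ((differentiable_coordP f x).1 dfx j).
  apply: Ckg_ext (IH _ (cf v) j) => // x Ux.
  by rewrite derive_coord//; exact: df.
move=> H; have -> : f = (fun y => \sum_(j < n) (f y 0 j *: (delta_mx 0 j : 'rV[R]_n))).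
  by apply/funext => y; rewrite [LHS]row_sum_delta.
by apply: Ckg_sum => // j _; exact: Ckg_scalel.
Qed.

(** With a scalar outer function the chain rule is a sum over coordinates of products of scalar
    functions, which [Ckg_mul] and [Ckg_sum] handle. Vector values follow by coordinates. *)
Lemma Ckg_comp_scalar m n k (U : set 'rV[R]_m) (V : set 'rV[R]_n)
    (f : 'rV[R]_m -> 'rV[R]_n) (g : 'rV[R]_n -> R) : open U -> open V ->
  (forall x, U x -> V (f x)) -> Ckg k U f -> Ckg k V g -> Ckg k U (g \o f).
Proof.
move=> oU oV UV; elim: k g => [|k IH] g Cf Cg.
  move: Cf Cg => /Ckg0P-/(_ oU) cf /Ckg0P-/(_ oV) cg; apply/Ckg0P => // x Ux.
  by apply: continuous_comp; [exact: cf|exact/cg/UV].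
have Cf' := Ckg_weaken oU Cf.
case: Cf Cg => [df cf] [dg cg]; split=> [x Ux|v].
  by apply: differentiable_comp; [exact: df|exact/dg/UV].
pose D x := \sum_(j < n) ((fun y => 'D_v f y 0 j) * ('D_(delta_mx 0 j) g \o f)) x.
apply: (@Ckg_ext _ _ _ _ _ D) => // [x Ux|].
  have dfx := df _ Ux; have dgx := dg _ (UV _ Ux).
  have dgf := differentiable_comp dfx dgx.
  rewrite (deriveE _ dgf) (diff_comp dfx dgx) /= -(deriveE _ dfx) /D.
  rewrite [X in _ = 'd g (f x) X]row_sum_delta linear_sum; apply: eq_bigr => j _.
  by rewrite linearZ /= fctE -deriveE.
apply: Ckg_sum => // j _; apply: Ckg_mul => //.
  by move: j; apply/Ckg_coordP => //; exact: cf.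
by apply: IH => //; exact: cg.
Qed.

Lemma Ckg_comp m n p k (U : set 'rV[R]_m) (V : set 'rV[R]_n)
    (f : 'rV[R]_m -> 'rV[R]_n) (g : 'rV[R]_n -> 'rV[R]_p) : open U -> open V ->
  (forall x, U x -> V (f x)) -> Ckg k U f -> Ckg k V g -> Ckg k U (g \o f).
Proof.
move=> oU oV UV Cf /Ckg_coordP-/(_ oV) Cg; apply/Ckg_coordP => // j.
exact: (Ckg_comp_scalar oU oV UV Cf (Cg j)).
Qed.

Lemma mvt01 (g dg : R -> R) :
  (forall t : R, t \in `[0, 1]%R -> is_derive t (1 : R) g (dg t)) ->
  {within `[0, 1], continuous g} ->
  exists2 t : R, t \in `[0, 1]%R & g 1 - g 0 = dg t * (1 - 0).
Proof.
move=> dp H2.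
have H1 (t : R) : t \in `]0, 1[%R -> is_derive t (1 : R) g (dg t).
  by move=> t01; apply: dp; exact: subset_itv_oo_cc.
exact: (@MVT_segment R g dg 0 1 ler01 H1 H2).
Qed.

(** The mean value theorem on the segment from [a] to [b] turns the increment into the differential
    at an intermediate point, which is close to the one at [x] by continuity of the partial
    derivatives. The theorem requires scalar values. *)
Lemma C1_strict_scalar m (U : set 'rV[R]_m) (f : 'rV[R]_m -> R) x : open U -> U x ->
  Ckg 1 U f -> forall e : R, 0 < e -> exists2 d, 0 < d &
    (forall a : 'rV[R]_m, `|a - x| < d -> U a) /\
    forall a b : 'rV[R]_m, `|a - x| < d -> `|b - x| < d ->
      `|f b - f a - 'd f x (b - a)| <= e * `|b - a|.
Proof.
move=> oU Ux [df cf] e e0.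
have c (j : 'I_m) : {for x, continuous ('D_(delta_mx 0 j) f)}.
  by move: (cf (delta_mx 0 j)) => /Ckg0P-/(_ oU); apply.
(* Each of the [m] partial derivatives may contribute an error [e']; dividing by [m.+1] also covers
   [m = 0]. *)
pose e' := e / m.+1%:R.
have e'0 : 0 < e' by rewrite divr_gt0.
have [d d0 H] : exists2 d, 0 < d & forall a : 'rV[R]_m, `|a - x| < d -> U a /\
    forall j : 'I_m, `|'D_(delta_mx 0 j) f a - 'D_(delta_mx 0 j) f x| <= e'.
  have N : nbhs x (fun a => U a /\
    forall j : 'I_m, `|'D_(delta_mx 0 j) f a - 'D_(delta_mx 0 j) f x| <= e').
    apply: filterI; first exact: open_nbhs_nbhs.
    apply: nbhs_forall => j.
    have /cvgrPdist_le/(_ _ e'0) := c j.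
    by apply: filterS => a; rewrite distrC.
  move: N => /nbhs_normP[d /= d0 {}H]; exists d => // a.
  by rewrite distrC => /H.
exists d => //; split=> [a /H[]//|a b ad bd].
pose p (t : R) : 'rV[R]_m := a + t *: (b - a).
have pd (t : R) : t \in `[0, 1]%R -> `|p t - x| < d.
  rewrite in_itv /= => /andP[t0 t1].
  have -> : p t - x = (1 - t) *: (a - x) + t *: (b - x).
    by apply/rowP => j; rewrite !mxE; ring.
  apply: (le_lt_trans (ler_normD _ _)).
  rewrite !normrZ (ger0_norm t0) ger0_norm ?subr_ge0//.
  have [->|t'] := eqVneq t 0; first by rewrite subr0 mul0r mul1r addr0.
  have : (1 - t) * `|a - x| + t * `|b - x| < (1 - t) * d + t * d.
    apply: ler_ltD; first by rewrite ler_wpM2l ?subr_ge0// ltW.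
    by rewrite ltr_pM2l// lt_def t' t0.
  by rewrite -mulrDl subrK mul1r.
have dp (t : R) : t \in `[0, 1]%R -> is_derive t (1 : R) (f \o p) ('d f (p t) (b - a)).
  move=> /pd/H[/df dfp _].
  have E : (fun h : R => h^-1 *: (((f \o p) \o shift t) (h *: 1) - (f \o p) t)) =
      (fun h : R => h^-1 *: ((f \o shift (p t)) (h *: (b - a)) - f (p t))).
    apply/funext => h /=; congr (_ *: (f _ - _)).
    by rewrite /p scalerDl -[h *: 1]/(h * 1) mulr1 addrCA.
  have dfpv := @diff_derivable _ _ _ _ _ (b - a) dfp.
  apply: DeriveDef; first by rewrite /derivable E.
  by rewrite /derive E -[LHS]/('D_(b - a) f (p t)) deriveE.
have [t t01 E] : exists2 t : R, t \in `[0, 1]%R & f (p 1) - f (p 0) = 'd f (p t) (b - a) * (1 - 0).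
  apply: (@mvt01 (f \o p) (fun t => 'd f (p t) (b - a)) dp).
  apply: continuous_in_subspaceT => t /[!inE] /pd/H[/df dfp _].
  apply: continuous_comp; last exact: differentiable_continuous.
  apply: continuousD; first exact: cst_continuous.
  exact: continuousZr_tmp.
have p1 : p 1 = b by rewrite /p scale1r addrC subrK.
have p0 : p 0 = a by rewrite /p scale0r addr0.
move: E; rewrite subr0 mulr1 p1 p0 => E.
have [Upt ptx] := H _ (pd _ t01).
have dE (z : 'rV[R]_m) : differentiable f z ->
    'd f z (b - a) = \sum_(j < m) (b - a) 0 j *: 'D_(delta_mx 0 j) f z.
  move=> dz; rewrite [X in 'd f z X]row_sum_delta linear_sum; apply: eq_bigr => j _.
  by rewrite linearZ /= deriveE.
have E1 := dE _ (df _ Upt).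
have E2 := dE _ (df _ Ux).
have -> : f b - f a - 'd f x (b - a) =
    \sum_(j < m) (b - a) 0 j *: 'D_(delta_mx 0 j) f (p t) -
    \sum_(j < m) (b - a) 0 j *: 'D_(delta_mx 0 j) f x.
  by congr (_ - _) => //; exact: etrans E E1.
rewrite -sumrB; apply: le_trans (ler_norm_sum _ _ _) _.
apply: (@le_trans _ _ (\sum_(j < m) `|b - a| * e')).
  apply: ler_sum => j _; rewrite -scalerBr normrZ.
  by apply: ler_pM => //; exact: ler_coord_norm.
rewrite sumr_const card_ord -mulrnAr mulrC ler_wpM2r// /e'.
by rewrite -mulr_natr mulrAC ler_pdivrMr// ler_wpM2l// ?ltW// ltr_nat.
Qed.

Lemma C1_strict m n (U : set 'rV[R]_m) (f : 'rV[R]_m -> 'rV[R]_n) x : open U -> U x ->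
  Ckg 1 U f -> forall e : R, 0 < e -> exists2 d, 0 < d &
    (forall a : 'rV[R]_m, `|a - x| < d -> U a) /\
    forall a b : 'rV[R]_m, `|a - x| < d -> `|b - x| < d ->
      `|f b - f a - 'd f x (b - a)| <= e * `|b - a|.
Proof.
move=> oU Ux Cf e e0; have [df _] := Cf.
have H j := C1_strict_scalar oU Ux ((Ckg_coordP 1 f oU).1 Cf j) e0.
have [dU dU0 HU] : exists2 d : R, 0 < d & forall a : 'rV[R]_m, `|a - x| < d -> U a.
  have /nbhs_normP[d /= d0 {}H] := open_nbhs_nbhs (conj oU Ux).
  by exists d => // a ax; apply: H; rewrite /ball_ /= distrC.
pose d j := projT1 (cid2 (H j)).
have d0 j : 0 < d j by rewrite /d; case: (cid2 _).
have dH j : forall a b : 'rV[R]_m, `|a - x| < d j -> `|b - x| < d j ->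
      `|f b 0 j - f a 0 j - 'd (fun y => f y 0 j) x (b - a)| <= e * `|b - a|.
  by rewrite /d; case: (cid2 _) => ? ? [].
(* The minimum starts from [dU], so the ball lies in [U] even when [n = 0] and there are no
   coordinates. *)
pose r := \big[Order.min/dU]_(j < n) d j.
exists r; first by apply: lt_bigmin.
split=> [a ar|a b ar br].
  by apply: HU; apply: lt_le_trans ar _; exact: bigmin_le_id.
apply: norm_coord_le => [|j]; first by rewrite mulr_ge0// ltW.
have rd : r <= d j by exact: bigmin_le_cond.
have := dH j a b (lt_le_trans ar rd) (lt_le_trans br rd).
rewrite -deriveE; last exact: ((differentiable_coordP f x).1 (df _ Ux) j).
by rewrite derive_coord ?deriveE ?mxE//; exact: df.
Qed.

End Coord.

(** * Local inversion *)

(** Makes row vectors a complete normed module, as the fixed point theorem in [strict_surj]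
    requires. *)
HB.instance Definition _ (R : realType) m n := Complete.on 'M[R]_(m, n).

Section LocalInverse.
Context {R : realType}.

(** Strict differentiability: both points vary near [x]. This makes an immersion injective near [x]
    and the Newton map of [strict_surj] a contraction. *)
Definition strict_at m n (f : 'rV[R]_m -> 'rV[R]_n) (x : 'rV[R]_m) (J : 'M[R]_(m, n)) :=
  forall e : R, 0 < e -> exists2 d : R, 0 < d &
    forall a b : 'rV[R]_m, `|a - x| < d -> `|b - x| < d ->
      `|f b - f a - (b - a) *m J| <= e * `|b - a|.

Lemma C1_strictJ m n (U : set 'rV[R]_m) (f : 'rV[R]_m -> 'rV[R]_n) x : open U -> U x ->
  Ckg 1 U f -> strict_at f x (jacobian f x).
Proof.
move=> oU Ux Cf e e0; have [d d0 [_ H]] := C1_strict oU Ux Cf e0.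
exists d => // a b ad bd; have := H _ _ ad bd.
by rewrite /jacobian mul_rV_lin1.
Qed.

Lemma jacobian_eps m n (f : 'rV[R]_m -> 'rV[R]_n) x : differentiable f x ->
  forall e : R, 0 < e -> exists2 d : R, 0 < d &
     forall h : 'rV[R]_m, `|h| < d -> `|f (h + x) - f x - h *m jacobian f x| <= e * `|h|.
Proof.
move=> df e e0; have [d d0 H] := diff_eps df e0.
exists d => // h /H; by rewrite /jacobian mul_rV_lin1.
Qed.

Lemma eps_differentiable_jacobian m n (f : 'rV[R]_m -> 'rV[R]_n) x (A : 'M[R]_(m, n)) :
  (forall e : R, 0 < e -> exists2 d : R, 0 < d &
     forall h : 'rV[R]_m, `|h| < d -> `|f (h + x) - f x - h *m A| <= e * `|h|) ->
  differentiable f x /\ jacobian f x = A.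
Proof.
move=> H; pose L := mulmxr A : {linear 'rV[R]_m -> 'rV[R]_n}.
have [|df dE] := @eps_differentiable R _ _ f L x (@linear_rV_continuous _ _ _ L); first exact: H.
split=> //; apply/row_matrixP => i; rewrite !rowE /jacobian mul_rV_lin1.
by rewrite dE.
Qed.

Lemma mx_bound m n (A : 'M[R]_(m, n)) :
  exists2 c : R, 0 < c & forall w : 'rV[R]_m, `|w *m A| <= c * `|w|.
Proof. exact: (linear_lipschitz (@linear_rV_continuous _ _ _ (mulmxr A))). Qed.

Lemma strict_lower m n (f : 'rV[R]_m -> 'rV[R]_n) x J : strict_at f x J -> row_free J ->
  exists2 d : R, 0 < d & exists2 c : R, 0 < c &
    forall a b : 'rV[R]_m, `|a - x| < d -> `|b - x| < d -> `|b - a| <= c * `|f b - f a|.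
Proof.
move=> sf Jf; have [c c0 H] := mx_bound (pinvmx J).
(* Since [pinvmx J] enlarges norms at most by [c], an error of [1 / (2c)] costs at most half of the
   distance between the points. Absorbing it on the left leaves the constant [2c]. *)
have e0 : 0 < (c *+ 2)^-1 by rewrite invr_gt0 mulrn_wgt0.
have [d d0 {}sf] := sf _ e0.
exists d => //; exists (c *+ 2); first by rewrite mulrn_wgt0.
move=> a b ad bd; have := sf _ _ ad bd; have := H ((b - a) *m J); rewrite mulmxKp//.
set w := b - a; set u := f b - f a => H1 H2.
have H3 : `|w *m J| <= `|u| + (c *+ 2)^-1 * `|w|.
  rewrite -(subKr u (w *m J)); apply: le_trans (ler_normB _ _) _.
  by rewrite lerD2l.
have : `|w| <= c * (`|u| + (c *+ 2)^-1 * `|w|) by apply: le_trans H1 _; rewrite ler_pM2l.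
have -> : c * (`|u| + (c *+ 2)^-1 * `|w|) = c * `|u| + `|w| / 2.
  by rewrite mulrDr; congr (_ + _); field; rewrite gt_eqF.
lra.
Qed.

(** Along a kernel vector of the Jacobian [f] moves by less than any prescribed fraction of the
    displacement, against the lower bound. This carries full rank from a point to its neighbours
    without talking of minors. *)
Lemma lower_row_free m n (f : 'rV[R]_m -> 'rV[R]_n) x (d c : R) : 0 < d -> 0 < c ->
  (forall b : 'rV[R]_m, `|b - x| < d -> `|b - x| <= c * `|f b - f x|) ->
  differentiable f x -> row_free (jacobian f x).
Proof.
move=> d0 c0 H df; apply: inj_row_free => v vJ.
have e0 : 0 < (c *+ 2)^-1 by rewrite invr_gt0 mulrn_wgt0.
have [d' d'0 D] := jacobian_eps df e0.
apply/eqP/negPn/negP => v0.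
have nv0 : 0 < `|v| by rewrite normr_gt0.
(* Scales [v] to length half of [min d d'], inside both balls and still nonzero. *)
pose t := Num.min d d' / 2 / `|v|.
have md : 0 < Num.min d d' by rewrite lt_min d0.
have t0 : 0 < t by rewrite !divr_gt0.
have tv : `|t *: v| = Num.min d d' / 2.
  by rewrite normrZ gtr0_norm// /t divfK ?gt_eqF.
have tvd : `|t *: v| < d by rewrite tv ltr_pdivrMr// gt_min; apply/orP; left; lra.
have tvd' : `|t *: v| < d' by rewrite tv ltr_pdivrMr// gt_min; apply/orP; right; lra.
have := H (t *: v + x); rewrite addrK => /(_ tvd).
have := D _ tvd'; rewrite -scalemxAl vJ scaler0 subr0.
move=> D1; rewrite leNgt => /negP; apply.
apply: (@le_lt_trans _ _ (c * ((c *+ 2)^-1 * `|t *: v|))); first by rewrite ler_pM2l.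
have -> : c * ((c *+ 2)^-1 * `|t *: v|) = `|t *: v| / 2.
  by field; rewrite gt_eqF.
have : 0 < `|t *: v| by rewrite tv divr_gt0.
by move=> ?; lra.
Qed.

(** Newton's method with the derivative frozen at [x]: the fixed points of [G] are the solutions of
    [f a = t], and [G] contracts by [1/2] a closed ball around [x]. *)
Lemma strict_surj n (f : 'rV[R]_n -> 'rV[R]_n) x J : strict_at f x J -> J \in unitmx ->
  forall e : R, 0 < e -> exists2 d : R, 0 < d & forall t : 'rV[R]_n, `|t - f x| < d ->
    exists2 a : 'rV[R]_n, `|a - x| <= e & f a = t.
Proof.
move=> sf Ju e e0; have [c c0 H] := mx_bound (invmx J).
have e'0 : 0 < (c *+ 2)^-1 by rewrite invr_gt0 mulrn_wgt0.
have [d d0 {}sf] := sf _ e'0.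
pose r := Num.min e (d / 2).
have r0 : 0 < r by rewrite lt_min e0 divr_gt0.
have rd : r < d by rewrite gt_min; apply/orP; right; lra.
exists (r / (c *+ 2)); first by rewrite divr_gt0// mulrn_wgt0.
move=> t ht.
pose U : set 'rV[R]_n := closed_ball_ (fun z => `|z|) x r.
pose G a := a - (f a - t) *m invmx J.
have GL (a b : 'rV[R]_n) : `|a - x| <= r -> `|b - x| <= r -> `|G b - G a| <= 2^-1 * `|b - a|.
  move=> ar br.
  have -> : G b - G a = - ((f b - f a - (b - a) *m J) *m invmx J).
    rewrite /G [in RHS]mulmxBl mulmxK// !mulmxBl !opprB.
    move: (f b *m _) (f a *m _) (t *m _) => u v w.
    by apply/rowP => i; rewrite !mxE; ring.
  rewrite normrN; apply: le_trans (H _) _.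
  have := sf _ _ (le_lt_trans ar rd) (le_lt_trans br rd).
  rewrite -(ler_pM2l c0) => /le_trans; apply.
  rewrite mulrA; apply: ler_wpM2r => //.
  rewrite le_eqVlt; apply/orP; left; apply/eqP.
  by field; rewrite gt_eqF.
have xx : `|x - x| <= r by rewrite subrr normr0 ltW.
have GU : {homo G : a / U a >-> U a}.
  move=> a; rewrite /U /closed_ball_ /= distrC => ar; rewrite distrC.
  (* Each summand is at most [r / 2]: the first by contraction, the second because [t] is within
     [r / (2c)] of [f x]. *)
  have -> : G a - x = (G a - G x) + (G x - x) by rewrite addrA subrK.
  apply: le_trans (ler_normD _ _) _.
  have := GL _ _ xx ar.
  have : `|G x - x| <= r / 2.
    rewrite /G addrAC subrr add0r normrN; apply: le_trans (H _) _.
    have := ltW ht; rewrite distrC -(ler_pM2l c0) => /le_trans; apply.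
    rewrite le_eqVlt; apply/orP; left; apply/eqP.
    by field; rewrite gt_eqF.
  by move=> *; lra.
have [|||a Ua aG] := @banach_fixed_point R ('rV[R]_n : completeNormedModType R) U (mkfun_fun GU).
- have q0 : (0 : R) <= 2^-1 by rewrite invr_ge0.
  exists (NngNum q0); split=> /=; first by rewrite invf_lt1// ltr1n.
  move=> [a b] /= [Ua Ub]; rewrite (distrC a b) (distrC _ (mkfun_fun GU b)); apply: GL.
    by move: Ua; rewrite /U /closed_ball_ /= distrC.
  by move: Ub; rewrite /U /closed_ball_ /= distrC.
- exact: closed_closed_ball_.
- by exists x; rewrite /U /closed_ball_ /=.
exists a.
  move: Ua; rewrite /U /closed_ball_ /= distrC => /le_trans; apply.
  by rewrite ge_min lexx.
have : (f a - t) *m invmx J = 0.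
  have : a = a - (f a - t) *m invmx J by exact: aG.
  by move/eqP; rewrite eq_sym -subr_eq0 addrAC subrr add0r oppr_eq0 => /eqP.
move/(congr1 (mulmx^~ J)); rewrite /= mulmxKV// mul0mx => /eqP.
by rewrite subr_eq0 => /eqP.
Qed.

End LocalInverse.

Lemma near_continuous (K : numFieldType) (V : topologicalType) (W : normedModType K)
    (f : V -> W) x :
  (forall e : K, 0 < e -> nbhs x [set y | `|f x - f y| < e]) -> {for x, continuous f}.
Proof. by move=> H; apply/cvgrPdist_lt. Qed.

Section InverseSmooth.
Context {R : realType}.

Lemma Ckg_det m n k (U : set 'rV[R]_m) (M : 'rV[R]_m -> 'M[R]_n) : open U ->
  (forall i j, Ckg k U (fun y => M y i j)) -> Ckg k U (fun y => \det (M y)).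
Proof.
move=> oU H; apply: Ckg_sum => // s _.
apply: (@Ckg_mul _ _ _ _ (cst ((-1) ^+ s)) (fun y => \prod_i M y i (s i))) => //.
  exact: Ckg_cst.
exact: Ckg_prod.
Qed.

Lemma Ckg_invmx m n k (U : set 'rV[R]_m) (M : 'rV[R]_m -> 'M[R]_n) : open U ->
  (forall x, U x -> M x \in unitmx) ->
  (forall i j, Ckg k U (fun y => M y i j)) -> forall i j, Ckg k U (fun y => invmx (M y) i j).
Proof.
move=> oU uM H i j.
apply: (@Ckg_ext _ _ _ _ _ ((fun y => (\det (M y))^-1) * (fun y => cofactor (M y) j i))) => //.
  by move=> y Uy; rewrite /invmx (uM _ Uy) !mxE.
apply: Ckg_mul => //.
  apply: Ckg_inv => //; last exact: Ckg_det.
  by move=> x /uM; rewrite unitmxE unitfE.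
apply: (@Ckg_mul _ _ _ _ (cst ((-1) ^+ (j + i))) (fun y => \det (row' j (col' i (M y))))) => //.
  exact: Ckg_cst.
apply: Ckg_det => // a b.
apply: (@Ckg_ext _ _ _ _ _ (fun y => M y (lift j a) (lift i b))) => //.
by move=> y _; rewrite !mxE.
Qed.

(** Bootstrapping: a continuous inverse is differentiable with Jacobian the inverse of that of [f]
    at [g b]. If [g] has class [k], this formula has class [k] too, hence [g] has class [k.+1]. *)
Lemma inverse_smooth n (f g : 'rV[R]_n -> 'rV[R]_n) (A B : set 'rV[R]_n) :
  open A -> open B -> (forall k, Ckg k A f) ->
  (forall b, B b -> A (g b) /\ f (g b) = b) ->
  (forall a, A a -> jacobian f a \in unitmx) ->
  (forall b, B b -> {for b, continuous g}) -> forall k, Ckg k B g.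
Proof.
move=> oA oB Cf gB Jf cg.
have dg b : B b -> differentiable g b /\ jacobian g b = invmx (jacobian f (g b)).
  move=> Bb; have [Aa fa] := gB _ Bb; set a := g b in Aa fa *.
  apply: eps_differentiable_jacobian => e e0.
  have sf := C1_strictJ oA Aa (Cf 1%N).
  have rf : row_free (jacobian f a) by rewrite row_free_unit; exact: Jf.
  have [d d0 [c c0 L]] := strict_lower sf rf.
  have [c' c'0 H] := mx_bound (invmx (jacobian f a)).
  have e'0 : 0 < e / (c' * c) by rewrite divr_gt0// mulr_gt0.
  have [d' d'0 {}sf] := sf _ e'0.
  have md : 0 < Num.min d d' by rewrite lt_min d0.
  have N : nbhs b [set y | B y /\ `|g y - a| < Num.min d d'].
    apply: filterI; first exact: open_nbhs_nbhs.
    have /cvgrPdist_lt/(_ _ md) := cg _ Bb.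
    by apply: filterS => y; rewrite /= distrC.
  move: N => /nbhs_normP[r /= r0 N]; exists r => // h hr.
  have [|Bh] := N (h + b); first by rewrite /ball_ /= opprD addrCA subrr addr0 normrN.
  rewrite lt_min => /andP[gd gd'].
  have [Aa' fa'] := gB _ Bh; set a' := g (h + b) in Aa' fa' gd gd' *.
  have aa z : 0 < z -> `|a - a| < z by rewrite subrr normr0.
  have L1 := L _ _ (aa _ d0) gd; have S1 := sf _ _ (aa _ d'0) gd'.
  have hE : h = f a' - f a by rewrite fa fa' addrK.
  (* The linearization error of [g] is the image of that of [f] under the inverse Jacobian; the
     lower bound [L] converts its size from the distance of [a'] and [a] to the norm of [h]. *)
  have -> : a' - a - h *m invmx (jacobian f a) =
     - ((f a' - f a - (a' - a) *m jacobian f a) *m invmx (jacobian f a)).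
    by rewrite mulmxBl (mulmxK (Jf _ Aa)) -hE opprB.
  rewrite normrN; apply: le_trans (H _) _.
  apply: (@le_trans _ _ (c' * (e / (c' * c) * (c * `|f a' - f a|)))).
    rewrite ler_pM2l//; apply: le_trans S1 _; rewrite ler_pM2l//.
  rewrite hE le_eqVlt; apply/orP; left; apply/eqP.
  by field; rewrite ?gt_eqF.
elim=> [|k IH]; first exact/Ckg0P.
split=> [b /dg[]//|v]; apply/Ckg_coordP => // j.
pose M y := invmx (jacobian f (g y)).
apply: (@Ckg_ext _ _ _ _ _ (fun y => \sum_i v 0 i *: M y i j)) => //.
  by move=> y /dg[dy Jy]; rewrite deriveEjacobian// mxE Jy.
apply: Ckg_sum => // i _.
apply: (@Ckg_mul _ _ _ _ (cst (v 0 i)) (fun y => M y i j)) => //; first exact: Ckg_cst.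
apply: Ckg_invmx => //.
  by move=> y /gB[/Jf].
move=> {}i {}j.
apply: (@Ckg_comp_scalar _ _ _ _ _ A g (fun x => jacobian f x i j)) => //.
  by move=> y /gB[].
have [df cf] := Cf k.+1.
apply: (@Ckg_ext _ _ _ _ _ (fun y => 'D_(delta_mx 0 i) f y 0 j)) => //.
  by move=> y Ay; rewrite deriveEjacobian; [rewrite -rowE mxE|exact: df].
exact: (Ckg_coordP k ('D_(delta_mx 0 i) f) oA).1 (cf _) j.
Qed.

Lemma immersion_nbhs m n (U : set 'rV[R]_m) (f : 'rV[R]_m -> 'rV[R]_n) x : open U -> U x ->
  Ckg 1 U f -> row_free (jacobian f x) ->
  exists2 d : R, 0 < d & exists2 c : R, 0 < c &
   [/\ forall a : 'rV[R]_m, `|a - x| < d -> U a,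
    forall a b : 'rV[R]_m, `|a - x| < d -> `|b - x| < d -> `|b - a| <= c * `|f b - f a| &
    forall a : 'rV[R]_m, `|a - x| < d -> row_free (jacobian f a)].
Proof.
move=> oU Ux Cf Jf.
have [d d0 [c c0 L]] := strict_lower (C1_strictJ oU Ux Cf) Jf.
have [d' d'0 HU] : exists2 d : R, 0 < d & forall a : 'rV[R]_m, `|a - x| < d -> U a.
  have /nbhs_normP[d' /= d'0 {}H] := open_nbhs_nbhs (conj oU Ux).
  by exists d' => // a ax; apply: H; rewrite /ball_ /= distrC.
exists (Num.min d d'); first by rewrite lt_min d0.
exists c; first exact: c0.
split=> [a|a b|a]; rewrite !lt_min.
- by move=> /andP[_ /HU].
- by move=> /andP[ad _] /andP[bd _]; exact: L.
move=> /andP[ad /HU Ua].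
(* The ball of this radius around [a] stays in the ball around [x] where the lower bound holds. *)
apply: (@lower_row_free _ _ _ f a (d - `|a - x|) c) => //; first by rewrite subr_gt0.
  move=> b; rewrite ltrBrDr => bd; apply: L => //; apply: le_lt_trans bd.
  by rewrite -{1}(subrK a b) -addrA ler_normD.
by have [df _] := Cf; exact: df.
Qed.

(** Smoothness is claimed for every left inverse [g] on [A], so that a chart representation of a
    given map can later play this role. *)
Lemma local_inverse n (U : set 'rV[R]_n) (f : 'rV[R]_n -> 'rV[R]_n) x : open U -> U x ->
  (forall k, Ckg k U f) -> jacobian f x \in unitmx ->
  exists A, [/\ open A, A x, A `<=` U, (forall a b, A a -> A b -> f a = f b -> a = b) &
    open (f @` A) /\
    forall g, (forall a, A a -> g (f a) = a) -> forall k, Ckg k (f @` A) g].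
Proof.
move=> oU Ux Cf Jx.
have [|d d0 [c c0 [dU L Jf]]] := immersion_nbhs oU Ux (Cf 1%N); first by rewrite row_free_unit.
pose A := [set a : 'rV[R]_n | `|a - x| < d].
have oA : open A.
  have -> : A = ball x d.
    by rewrite -ball_normE; apply/seteqP; split=> a; rewrite /A /ball_ /= distrC.
  exact: ball_open.
have injA a b : A a -> A b -> f a = f b -> a = b.
  move=> Aa Ab fab; have := L _ _ Aa Ab; rewrite fab subrr normr0 mulr0 normr_le0 subr_eq0.
  by move=> /eqP.
have JA a : A a -> jacobian f a \in unitmx by move=> /Jf; rewrite row_free_unit.
have ofA : open (f @` A).
  rewrite openE => _ [a Aa <-].
  (* Half the gap between [a] and the boundary of the ball keeps the preimages produced by
     [strict_surj] inside [A]. *)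
  have r0 : 0 < (d - `|a - x|) / 2 by rewrite divr_gt0// subr_gt0.
  have [s s0 H] := strict_surj (C1_strictJ oU (dU _ Aa) (Cf 1%N)) (JA _ Aa) r0.
  apply: (iffRL (nbhs_normP (f a : 'rV[R]_n) (f @` A))).
  exists s => //= t; rewrite /ball_ /= distrC => /H[b ba fb].
  exists b => //; rewrite /A /= -{1}(subrK a b) -addrA.
  apply: le_lt_trans (ler_normD _ _) _.
  by have : `|a - x| < d by []; lra.
exists A; split => //; first by rewrite /A /= subrr normr0.
split=> // g gf.
have gA b : (f @` A) b -> A (g b) /\ f (g b) = b by move=> [a Aa <-]; rewrite gf.
apply: (inverse_smooth oA ofA _ gA JA) => [k|b fAb]; first exact: Ckg_sub (Cf k).
apply: near_continuous => e e0.
have : nbhs b [set y | (f @` A) y /\ `|b - y| < e / c].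
  apply: filterI; first exact: open_nbhs_nbhs.
  apply: (iffRL (nbhs_normP (b : 'rV[R]_n) _)).
  by exists (e / c) => //=; rewrite divr_gt0.
apply: filterS => y [/= fAy yb].
have [Ay fy] := gA _ fAy; have [Ab fb] := gA _ fAb.
apply: le_lt_trans (L _ _ Ay Ab) _.
by rewrite fy fb mulrC -ltr_pdivlMr.
Qed.

End InverseSmooth.

(** * Smooth maps of manifolds *)

Section JacobianTools.
Context {R : realType}.

Lemma smooth_onE m n (U : set 'rV[R]_m) (f : 'rV[R]_m -> 'rV[R]_n) :
  smooth_on U f <-> forall k, Ckg k U f.
Proof. by split=> H k; apply/Ck_onE/H. Qed.

Lemma smooth_on_sub m n (U V : set 'rV[R]_m) (f : 'rV[R]_m -> 'rV[R]_n) :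
  V `<=` U -> smooth_on U f -> smooth_on V f.
Proof. by move=> VU /smooth_onE H; apply/smooth_onE => k; apply: Ckg_sub (H k). Qed.

Lemma smooth_on_ext m n (U : set 'rV[R]_m) (f g : 'rV[R]_m -> 'rV[R]_n) : open U ->
  (forall y, U y -> f y = g y) -> smooth_on U f -> smooth_on U g.
Proof. by move=> oU fg /smooth_onE H; apply/smooth_onE => k; apply: Ckg_ext (H k). Qed.

Lemma smooth_on_comp m n p (U : set 'rV[R]_m) (V : set 'rV[R]_n)
    (f : 'rV[R]_m -> 'rV[R]_n) (g : 'rV[R]_n -> 'rV[R]_p) : open U -> open V ->
  (forall x, U x -> V (f x)) -> smooth_on U f -> smooth_on V g -> smooth_on U (g \o f).
Proof.
move=> oU oV UV /smooth_onE Hf /smooth_onE Hg; apply/smooth_onE => k.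
exact: (Ckg_comp oU oV UV (Hf k) (Hg k)).
Qed.

Lemma smooth_on_diff m n (U : set 'rV[R]_m) (f : 'rV[R]_m -> 'rV[R]_n) x :
  smooth_on U f -> U x -> differentiable f x.
Proof. by move=> H Ux; have [df _] := H 1%N; exact: df. Qed.

Lemma smooth_on_cont m n (U : set 'rV[R]_m) (f : 'rV[R]_m -> 'rV[R]_n) x :
  smooth_on U f -> U x -> {for x, continuous f}.
Proof. by move=> H Ux; apply: differentiable_continuous; exact: smooth_on_diff Ux. Qed.

Lemma near_eq_jacobian m n (f g : 'rV[R]_m -> 'rV[R]_n) (x : 'rV[R]_m) :
  (\forall y \near x, f y = g y) -> differentiable f x ->
  differentiable g x /\ jacobian g x = jacobian f x.
Proof.
move=> fg df; have fgx := nbhs_singleton fg.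
apply: eps_differentiable_jacobian => e e0; have [d d0 H] := jacobian_eps df e0.
move: fg => /nbhs_normP[d' /= d'0 fg].
exists (Num.min d d'); first by rewrite lt_min d0.
move=> h; rewrite lt_min => /andP[hd hd'].
have := H _ hd; rewrite -fg -?fgx//= /ball_ /= opprD addrCA subrr addr0 normrN.
exact: hd'.
Qed.

Lemma jacobian_comp m n p (f : 'rV[R]_m -> 'rV[R]_n) (g : 'rV[R]_n -> 'rV[R]_p) x :
  differentiable f x -> differentiable g (f x) ->
  jacobian (g \o f) x = jacobian f x *m jacobian g (f x).
Proof.
move=> df dg; apply/row_matrixP => i.
rewrite row_mul !rowE -deriveEjacobian; last exact: (differentiable_comp df dg).
rewrite deriveE; last exact: (differentiable_comp df dg).
by rewrite (diff_comp df dg) /= /jacobian !mul_rV_lin1.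
Qed.

Lemma jacobian_id n (x : 'rV[R]_n) : jacobian id x = 1%:M.
Proof.
have [] := @eps_differentiable_jacobian R n n id x 1%:M; last by [].
move=> e e0; exists 1 => // h _; rewrite mulmx1 addrK subrr normr0.
by rewrite mulr_ge0// ltW.
Qed.

Lemma smooth_on_id n (U : set 'rV[R]_n) : open U -> smooth_on U (id : 'rV[R]_n -> 'rV[R]_n).
Proof.
move=> oU; apply/smooth_onE => k.
apply: (@Ckg_lin R n _ k U (idfun : {linear 'rV[R]_n -> 'rV[R]_n}) oU).
exact: linear_rV_continuous.
Qed.

Lemma openI_preimage (S T : topologicalType) (f : S -> T) (A : set S) (B : set T) :
  open A -> (forall x, A x -> {for x, continuous f}) -> open B -> open (A `&` f @^-1` B).
Proof.
move=> oA cf oB; rewrite openE => x [Ax Bx].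
apply: filterI; first exact: open_nbhs_nbhs.
by apply: (cf _ Ax); exact: open_nbhs_nbhs.
Qed.

End JacobianTools.

Section ChartLemmas.
Context {R : realType} {n : nat} {M : manifold R n}.
Implicit Types (c : mchart R n M) (V : set M).

Definition cimg c := c @` cdom c.

Lemma cimgP c u : cimg c u -> cdom c (cinv c u) /\ c (cinv c u) = u.
Proof. by move=> [x cx <-]; rewrite cfunK. Qed.

Lemma cimg_in c x : cdom c x -> cimg c (c x).
Proof. by move=> cx; exists x. Qed.

Lemma cfun_cont c x : cdom c x -> {for x, continuous c}.
Proof.
move=> cx; have := @cfun_continuous _ _ _ c.
rewrite continuous_open_subspace; last exact: cdom_open.
by apply; rewrite inE.
Qed.

Lemma cinv_cont c u : cimg c u -> {for u, continuous (cinv c)}.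
Proof.
move=> cu; have := @cinv_continuous _ _ _ c.
rewrite continuous_open_subspace; last exact: cimg_open.
by apply; rewrite inE.
Qed.

Lemma cimgI_open c V : open V -> open (c @` (cdom c `&` V)).
Proof.
move=> oV; have -> : c @` (cdom c `&` V) = cimg c `&` (cinv c) @^-1` V.
  apply/seteqP; split=> [_ [x [cx Vx] <-]|u [/cimgP[cu uE] Vu]].
    by split; [exact: cimg_in|rewrite /= cfunK].
  by exists (cinv c u).
by apply: openI_preimage => //; [exact: cimg_open|exact: cinv_cont].
Qed.

Lemma cinv_image_open c (U : set 'rV[R]_n) : open U -> open (cdom c `&` c @^-1` U).
Proof. by move=> oU; apply: openI_preimage => //; [exact: cdom_open|exact: cfun_cont]. Qed.

End ChartLemmas.

Section SmoothAt.
Context {R : realType}.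

(** Requiring that [U] be mapped into the domain of [d] keeps junk values out and already forces
    continuity of [f] at [x]. *)
Definition smooth_in m n (M : manifold R m) (N : manifold R n) (f : M -> N) (x : M)
    (c : mchart R m M) (d : mchart R n N) :=
  [/\ matlas c, matlas d, cdom c x, cdom d (f x) &
    exists U, [/\ open U, U (c x), U `<=` cimg c,
      forall u, U u -> cdom d (f (cinv c u)) & smooth_on U (chart_rep f c d)]].

Definition smooth_at m n (M : manifold R m) (N : manifold R n) (f : M -> N) (x : M) :=
  exists c d, smooth_in f x c d.

(** On the open set [X] the new representation is the old one between the two transition maps [t]
    and [s]; [A] and [B] are their Jacobians. *)
Lemma smooth_in_change m n (M : manifold R m) (N : manifold R n) (f : M -> N) (x : M)
    c d c' d' : smooth_in f x c d -> matlas c' -> matlas d' -> cdom c' x -> cdom d' (f x) ->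
  smooth_in f x c' d' /\
  exists (A : 'M[R]_m) (B : 'M[R]_n),
    jacobian (chart_rep f c' d') (c' x) = A *m jacobian (chart_rep f c d) (c x) *m B.
Proof.
move=> [Ac Ad cx dfx [U [oU Ux Uc Ud sU]]] Ac' Ad' c'x d'fx.
pose t := c \o cinv c'.
pose s := d' \o cinv d.
pose W := c' @` (cdom c' `&` cdom c).
pose Z := d @` (cdom d `&` cdom d').
have oW : open W by apply: cimgI_open; exact: cdom_open.
have oZ : open Z by apply: cimgI_open; exact: cdom_open.
have st : smooth_on W t by exact: matlas_compat.
have ss : smooth_on Z s by exact: matlas_compat.
pose Y := U `&` chart_rep f c d @^-1` Z.
have oY : open Y.
  by apply: openI_preimage oU _ oZ => u Uu; exact: (smooth_on_cont sU Uu).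
pose X := W `&` t @^-1` Y.
have oX : open X.
  by apply: openI_preimage oW _ oY => u Uu; exact: (smooth_on_cont st Uu).
have tx : t (c' x) = c x by rewrite /t /= cfunK.
have Xx : X (c' x).
  split; first by exists x.
  rewrite /preimage /mkset tx; split=> //.
  by exists (f x) => //; rewrite /chart_rep /= cfunK.
have XE u : X u -> [/\ cimg c' u, cdom c (cinv c' u), cdom d (f (cinv c' u)) &
    cdom d' (f (cinv c' u)) /\ chart_rep f c' d' u = (s \o (chart_rep f c d \o t)) u].
  move=> [[y [c'y cy] <-]]; rewrite /preimage /mkset /t /Y /= cfunK//.
  rewrite /setI /preimage /mkset => -[Ucy].
  have := Ud _ Ucy; rewrite cfunK// => dfy.
  rewrite /chart_rep /= !cfunK// => -[z [dz d'z] dzE].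
  have zE : z = f y by rewrite -(cfunK dz) dzE cfunK.
  subst z; split=> //; first exact: cimg_in.
  by split=> //; rewrite /chart_rep /s /t /= !cfunK.

have Et := smooth_on_comp oX oY (fun u (Xu : X u) => Xu.2)
  (smooth_on_sub (@subIsetl _ W _) st) (smooth_on_sub (@subIsetl _ U _) sU).
have Es := smooth_on_comp oX oZ (fun u (Xu : X u) => Xu.2.2) Et ss.
split.
  split=> //; exists X; split=> //.
  - by move=> u /XE[].
  - by move=> u /XE[_ _ _ []].
  by apply: (smooth_on_ext oX _ Es) => u /XE[_ _ _ [_ ->]].
exists (jacobian t (c' x)), (jacobian s (chart_rep f c d (c x))).
have Wx : W (c' x) by exists x.
have d1 := smooth_on_diff st Wx.
have d2 : differentiable (chart_rep f c d) (t (c' x)) by rewrite tx; exact: smooth_on_diff sU Ux.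
have d3 : differentiable s ((chart_rep f c d \o t) (c' x)).
  apply: (smooth_on_diff ss); rewrite /= tx; exists (f x) => //.
  by rewrite /chart_rep /= cfunK.
have E12 := jacobian_comp d1 d2.
have E3 := jacobian_comp (differentiable_comp d1 d2) d3.
have Nr : \forall u \near c' x, (s \o (chart_rep f c d \o t)) u = chart_rep f c' d' u.
  by apply: filterS (open_nbhs_nbhs (conj oX Xx)) => u /XE[_ _ _ []].
have [_ ->] := near_eq_jacobian Nr (differentiable_comp (differentiable_comp d1 d2) d3).
apply: (etrans E3); apply: (etrans (congr1 (mulmx^~ _) E12)).
exact: (congr1 (fun z => jacobian t (c' x) *m jacobian (chart_rep f c d) z *m
  jacobian s (chart_rep f c d z)) tx).
Qed.

End SmoothAt.

(* Failing unifications would otherwise unfold these and not terminate in practice. *)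
Local Opaque jacobian diff mxrank.

Section SmoothAtTheory.
Context {R : realType}.

Lemma has_rank_intro m n (M : manifold R m) (N : manifold R n) (f : M -> N) (x : M) c d r :
  matlas c -> matlas d -> cdom c x -> cdom d (f x) ->
  \rank (jacobian (chart_rep f c d) (c x)) = r -> has_rank f x r.
Proof. by move=> Ac Ad cx dx rk; exists c, d. Qed.

Lemma smooth_at_in m n (M : manifold R m) (N : manifold R n) (f : M -> N) (x : M) c d :
  smooth_at f x -> matlas c -> matlas d -> cdom c x -> cdom d (f x) -> smooth_in f x c d.
Proof.
by move=> [c0 [d0 H]] Ac Ad cx dx; have [] := smooth_in_change H Ac Ad cx dx.
Qed.

Lemma smooth_in_continuous m n (M : manifold R m) (N : manifold R n) (f : M -> N) (x : M) c d :
  smooth_in f x c d -> {for x, continuous f}.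
Proof.
move=> [Ac Ad cx dfx [U [oU Ux Uc Ud sU]]].
have E : \near x, cinv d (chart_rep f c d (c x)) = f x.
  apply: filterS (open_nbhs_nbhs (conj (cinv_image_open c oU) (conj cx Ux))) => y [cy Uy].
  have := Ud _ Uy; rewrite /chart_rep /= (cfunK cy) => dfy.
  by rewrite (cfunK dfy).
have fx := nbhs_singleton E.
have H : {for x, continuous (fun y => cinv d (chart_rep f c d (c y)))}.
  apply: (@continuous_comp _ _ _ (fun y => chart_rep f c d (c y)) (cinv d)).
    apply: (@continuous_comp _ _ _ c (chart_rep f c d)); first exact: cfun_cont.
    exact: (smooth_on_cont sU Ux).
  apply: cinv_cont; exists (f x) => //.
  by rewrite /chart_rep /= cfunK.
move: H; rewrite /prop_for /continuous_at fx; apply: cvg_trans.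
by apply: near_eq_cvg; apply: filterS E => y ->.
Qed.

Lemma smooth_at_continuous m n (M : manifold R m) (N : manifold R n) (f : M -> N) (x : M) :
  smooth_at f x -> {for x, continuous f}.
Proof. by move=> [c [d /smooth_in_continuous]]. Qed.

Lemma smooth_at_near m n (M : manifold R m) (N : manifold R n) (f : M -> N) (x : M) :
  smooth_at f x -> \forall y \near x, smooth_at f y.
Proof.
move=> [c [d [Ac Ad cx dfx [U [oU Ux Uc Ud sU]]]]].
apply: filterS (open_nbhs_nbhs (conj (cinv_image_open c oU) (conj cx Ux))) => y [cy Uy].
exists c, d; split=> //; last by exists U.
by have := Ud _ Uy; rewrite cfunK.
Qed.

Lemma smooth_mapP m n (M : manifold R m) (N : manifold R n) (f : M -> N) :
  smooth_map f <-> forall x, smooth_at f x.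
Proof.
split.
  move=> [cf sf] x.
  have [c Ac cx] := matlas_cover x; have [d Ad dx] := matlas_cover (f x).
  exists c, d; split=> //; exists (c @` (cdom c `&` f @^-1` cdom d)); split.
  - by apply: cimgI_open; move/continuousP: cf; apply; exact: cdom_open.
  - by exists x.
  - by move=> _ [y [cy _] <-]; exact: cimg_in.
  - by move=> _ [y [cy dy] <-]; rewrite cfunK.
  - exact: sf.
move=> H; have cf : continuous f by move=> x; exact: smooth_at_continuous.
split=> // c d Ac Ad; apply/smooth_onE => k.
apply: Ckg_local.
  by apply: cimgI_open; move/continuousP: cf; apply; exact: cdom_open.
move=> _ [x [cx dx] <-].
have [_ _ _ _ [U [oU Ux Uc Ud /smooth_onE sU]]] := smooth_at_in (H x) Ac Ad cx dx.
by exists U.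
Qed.

Lemma smooth_at_ext m n (M : manifold R m) (N : manifold R n) (f g : M -> N) (x : M) :
  smooth_at f x -> (\forall y \near x, f y = g y) ->
  smooth_at g x /\ forall r, has_rank f x r -> has_rank g x r.
Proof.
move=> sf fg; have fgx := nbhs_singleton fg.
have key c d : matlas c -> matlas d -> cdom c x -> cdom d (f x) ->
    smooth_in g x c d /\ jacobian (chart_rep g c d) (c x) = jacobian (chart_rep f c d) (c x).
  move=> Ac Ad cx dfx.
  have [_ _ _ _ [U [oU Ux Uc Ud sU]]] := smooth_at_in sf Ac Ad cx dfx.
  move: fg; rewrite /prop_near1 nbhsE => -[V [oV Vx] VE].
  have oW := @cimgI_open _ _ _ c _ oV.
  pose W := U `&` c @` (cdom c `&` V).
  have oW' : open W by exact: openI.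
  have Wx : W (c x) by split=> //; exists x.
  have WE u : W u -> chart_rep f c d u = chart_rep g c d u.
    by move=> [_ [y [cy Vy] <-]]; rewrite /chart_rep /= cfunK// VE.
  split.
    split=> //; first by rewrite -fgx.
    exists W; split=> //.
    - by move=> u [/Uc].
    - move=> u [/Ud + [y [cy Vy] yu]]; rewrite -yu cfunK//.
      by rewrite VE.
    - exact: (smooth_on_ext oW' WE (smooth_on_sub (@subIsetl _ U _) sU)).
  have [] := @near_eq_jacobian _ _ _ (chart_rep f c d) (chart_rep g c d) (c x).
  - by apply: filterS (open_nbhs_nbhs (conj oW' Wx)).
  - exact: (smooth_on_diff sU Ux).
  - by [].
split.
  have [c [d [Ac Ad cx dfx _]]] := sf.
  by exists c, d; have [] := key _ _ Ac Ad cx dfx.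
move=> r [c [d [Ac Ad cx dfx rk]]]; have [_ E] := key _ _ Ac Ad cx dfx.
apply: (has_rank_intro Ac Ad cx); first by rewrite -fgx.
exact: etrans (congr1 (fun A => \rank A) E) rk.
Qed.

(** Changing charts in both directions factors each Jacobian through the other, so each rank bounds
    the other. *)
Lemma has_rankP m n (M : manifold R m) (N : manifold R n) (f : M -> N) (x : M) c d r :
  smooth_in f x c d -> has_rank f x r -> \rank (jacobian (chart_rep f c d) (c x)) = r.
Proof.
move=> sf [c' [d' [Ac' Ad' cx' dx' <-]]].
have [sf' [A [B E]]] := smooth_in_change sf Ac' Ad' cx' dx'.
have [Ac Ad cx dx _] := sf.
have [_ [A' [B' E']]] := smooth_in_change sf' Ac Ad cx dx.
have le a b (X : 'M[R]_(a, b)) (P : 'M[R]_a) (Q : 'M[R]_b) : (\rank (P *m X *m Q) <= \rank X)%N.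
  by apply: leq_trans (mxrankM_maxl _ _) _; exact: mxrankM_maxr.
apply/eqP; rewrite eqn_leq.
apply/andP; split.
  exact: leq_trans (eq_leq (congr1 (fun A => \rank A) E')) (le _ _ _ _ _).
exact: leq_trans (eq_leq (congr1 (fun A => \rank A) E)) (le _ _ _ _ _).
Qed.

Lemma smooth_in_comp m n p (M : manifold R m) (N : manifold R n) (P : manifold R p)
    (f : M -> N) (g : N -> P) (x : M) c d e :
  smooth_in f x c d -> smooth_in g (f x) d e ->
  smooth_in (g \o f) x c e /\
  jacobian (chart_rep (g \o f) c e) (c x) =
  jacobian (chart_rep f c d) (c x) *m jacobian (chart_rep g d e) (d (f x)).
Proof.
move=> [Ac Ad cx dx [U [oU Ux Uc Ud sU]]] [_ Ae _ ex [V [oV Vx Vc Ve sV]]].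
pose W := U `&` chart_rep f c d @^-1` V.
have oW : open W.
  by apply: openI_preimage oU _ oV => u Uu; exact: (smooth_on_cont sU Uu).
have fx : chart_rep f c d (c x) = d (f x) by rewrite /chart_rep /= cfunK.
have Wx : W (c x) by split=> //; rewrite /preimage /mkset fx.
have WE u : W u -> (chart_rep g d e \o chart_rep f c d) u = chart_rep (g \o f) c e u.
  by move=> [/Ud du _]; rewrite /chart_rep /= cfunK.
have S := smooth_on_comp oW oV (fun u (Wu : W u) => Wu.2)
   (smooth_on_sub (@subIsetl _ U _) sU) sV.
split.
  split=> //; exists W; split=> //.
  - by move=> u [/Uc].
  - move=> u [/Ud du]; rewrite /preimage /mkset /chart_rep /= => /Ve.
    by rewrite cfunK.
  - exact: (smooth_on_ext oW WE S).
have d1 := smooth_on_diff sU Ux.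
have d2 : differentiable (chart_rep g d e) (chart_rep f c d (c x)).
  by apply: (smooth_on_diff sV); rewrite fx.
have Nr : \forall u \near c x, (chart_rep g d e \o chart_rep f c d) u = chart_rep (g \o f) c e u.
  exact: filterS (open_nbhs_nbhs (conj oW Wx)).
have [_ E] := near_eq_jacobian Nr (differentiable_comp d1 d2).
apply: (etrans E); apply: (etrans (jacobian_comp d1 d2)).
exact: (congr1 (fun z => jacobian (chart_rep f c d) (c x) *m jacobian (chart_rep g d e) z) fx).
Qed.

Lemma smooth_at_comp m n p (M : manifold R m) (N : manifold R n) (P : manifold R p)
    (f : M -> N) (g : N -> P) (x : M) :
  smooth_at f x -> smooth_at g (f x) -> smooth_at (g \o f) x.
Proof.
move=> [c [d sf]] [d' [e sg]].
have [_ Ad _ dx _] := sf; have [_ Ae _ ex _] := sg.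
have sg' := smooth_at_in (ex_intro _ d' (ex_intro _ e sg)) Ad Ae dx ex.
by exists c, e; have [] := smooth_in_comp sf sg'.
Qed.

Lemma immersion_comp m n p (M : manifold R m) (N : manifold R n) (P : manifold R p)
    (f : M -> N) (g : N -> P) (x : M) :
  smooth_at f x -> smooth_at g (f x) -> has_rank f x m -> has_rank g (f x) n ->
  has_rank (g \o f) x m.
Proof.
move=> [c [d sf]] [d' [e sg]] rf rg.
have [_ Ad _ dx _] := sf; have [_ Ae _ ex _] := sg.
have sg' := smooth_at_in (ex_intro _ d' (ex_intro _ e sg)) Ad Ae dx ex.
have [sgf E] := smooth_in_comp sf sg'.
have [Ac _ cx _ _] := sf.
apply: (has_rank_intro Ac Ae cx ex).
apply: (etrans (congr1 (fun A => \rank A) E)).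
rewrite mxrankMfree; first exact: has_rankP sf rf.
by rewrite /row_free; apply/eqP; exact: has_rankP sg' rg.
Qed.

Lemma smooth_at_id m (M : manifold R m) (x : M) :
  smooth_at (id : M -> M) x /\ has_rank (id : M -> M) x m.
Proof.
have [c Ac cx] := matlas_cover x.
have E u : cimg c u -> id u = chart_rep (id : M -> M) c c u by move=> /cimgP[_ /=].
have s : smooth_in (id : M -> M) x c c.
  split=> //; exists (cimg c); split=> //.
  - exact: cimg_open.
  - exact: cimg_in.
  - by move=> u /cimgP[].
  - by apply: (smooth_on_ext _ E); [exact: cimg_open|apply: smooth_on_id; exact: cimg_open].
split; first by exists c, c.
apply: (has_rank_intro Ac Ac cx cx).
have Nr : \forall u \near c x, id u = chart_rep (id : M -> M) c c u.
  by apply: filterS (open_nbhs_nbhs (conj (@cimg_open _ _ _ c) (cimg_in cx))).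
have [|_ E'] := near_eq_jacobian Nr.
  apply: (@smooth_on_diff R m m (cimg c)); last exact: cimg_in.
  by apply: smooth_on_id; exact: cimg_open.
apply: (etrans (congr1 (fun A => \rank A) (etrans E' (jacobian_id _)))).
exact: mxrank1.
Qed.

Lemma immersion_near m n (M : manifold R m) (N : manifold R n) (f : M -> N) (x : M) :
  smooth_at f x -> has_rank f x m ->
  exists V, [/\ open V, V x, forall y, V y -> smooth_at f y /\ has_rank f y m &
    forall y z, V y -> V z -> f y = f z -> y = z].
Proof.
move=> sf rf; have [c [d sfi]] := sf.
have [Ac Ad cx dx [U [oU Ux Uc Ud sU]]] := sfi.
have Jx : row_free (jacobian (chart_rep f c d) (c x)).
  by apply/eqP; exact: has_rankP sfi rf.
have [r r0 [C C0 [rU L J]]] := immersion_nbhs oU Ux ((smooth_onE _ _).1 sU 1%N) Jx.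
pose B := [set u : 'rV[R]_m | `|u - c x| < r].
have oB : open B.
  have -> : B = ball (c x) r.
    by rewrite -ball_normE; apply/seteqP; split=> a; rewrite /B /ball_ /= distrC.
  exact: ball_open.
have Bx : B (c x) by rewrite /B /= subrr normr0.
exists (cdom c `&` c @^-1` B); split.
- exact: cinv_image_open.
- by split.
- move=> y [cy By].
  have Uy := rU _ By; have := Ud _ Uy; rewrite (cfunK cy) => dy.
  have s : smooth_in f y c d by split; [..|exists U].
  split; first by exists c, d.
  by apply: (has_rank_intro Ac Ad cy dy); apply/eqP; exact: J.
move=> y z [cy By] [cz Bz] fyz.
have := L _ _ By Bz; rewrite /chart_rep /= (cfunK cy) (cfunK cz) fyz.
rewrite subrr normr0 mulr0 normr_le0 subr_eq0.
by move=> /eqP /(congr1 (cinv c)); rewrite (cfunK cy) (cfunK cz) => ->.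
Qed.

Lemma local_diffeo n (M N : manifold R n) (f : M -> N) (x : M) :
  smooth_at f x -> has_rank f x n ->
  exists V, [/\ open V, V x, forall y, V y -> smooth_at f y,
    forall y z, V y -> V z -> f y = f z -> y = z & open (f @` V) /\
    forall g, (forall y, V y -> g (f y) = y) -> forall y, V y ->
      smooth_at g (f y) /\ has_rank g (f y) n].
Proof.
move=> sf rf; have [c [d sfi]] := sf.
have [Ac Ad cx dx [U [oU Ux Uc Ud sU]]] := sfi.
have Jx : jacobian (chart_rep f c d) (c x) \in unitmx.
  by rewrite -row_free_unit; apply/eqP; exact: has_rankP sfi rf.
have [A [oA Ax AU injA [ofA ginv]]] := local_inverse oU Ux ((smooth_onE _ _).1 sU) Jx.
have Acd u : A u -> cimg c u by move=> /AU/Uc.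
pose V := cdom c `&` c @^-1` A.
have VE : chart_rep f c d @` A = d @` (f @` V).
  apply/seteqP; split=> [_ [u Au <-]|_ [_ [y [cy Ay] <-] <-]].
    have [cu uE] := cimgP (Acd _ Au).
    exists (f (cinv c u)) => //; exists (cinv c u) => //.
    by split=> //; rewrite /preimage /mkset uE.
  by exists (c y) => //; rewrite /chart_rep /= cfunK.
have Vd y : V y -> cdom d (f y).
  by move=> [cy /AU/Ud]; rewrite cfunK.
have fVE : f @` V = cdom d `&` d @^-1` (chart_rep f c d @` A).
  apply/seteqP; split=> [_ [y Vy <-]|z [dz]].
    by split; [exact: Vd|rewrite VE; exists (f y) => //; exists y].
  rewrite /preimage /mkset VE => -[_ [y Vy <-]].
  by move=> /(congr1 (cinv d)); rewrite !cfunK//; [move=> <-; exists y|exact: Vd].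
exists V; split.
- exact: cinv_image_open.
- by split.
- move=> y Vy; have [cy Ay] := Vy; exists c, d; split=> //; first exact: Vd.
  by exists U; split=> //; exact: AU.
- move=> y z [cy Ay] [cz Az] fyz.
  have : c y = c z by apply: injA => //; rewrite /chart_rep /= !cfunK// fyz.
  by move=> /(congr1 (cinv c)); rewrite !cfunK.
split; first by rewrite fVE; exact: cinv_image_open.
move=> g gf y Vy; have [cy Ay] := Vy.
pose G := chart_rep g d c.
have GE u : A u -> G (chart_rep f c d u) = u.
  move=> Au; have [cu uE] := cimgP (Acd _ Au).
  have V' : V (cinv c u) by split=> //; rewrite /preimage /mkset uE.
  rewrite /G /chart_rep /= cfunK; last exact: Vd.
  by rewrite gf.
have sG : smooth_on (chart_rep f c d @` A) G by apply/smooth_onE; exact: ginv.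
have fy : chart_rep f c d (c y) = d (f y) by rewrite /chart_rep /= cfunK.
have sg : smooth_in g (f y) d c.
  split=> //; first exact: Vd.
    by rewrite gf.
  exists (chart_rep f c d @` A); split=> //.
  - by exists (c y).
  - by move=> _ [u Au <-]; apply: cimg_in; exact/Ud/AU.
  - move=> _ [u Au <-]; have [cu uE] := cimgP (Acd _ Au).
    have V' : V (cinv c u) by split=> //; rewrite /preimage /mkset uE.
    rewrite /chart_rep /= cfunK; last exact: Vd.
    by rewrite gf.
split; first by exists d, c.
have sfy : smooth_in f y c d.
  by split=> //; [exact: Vd|exists U; split=> //; exact: AU].
have [_ E] := smooth_in_comp sfy sg.
(* Since [g] inverts [f] near [y], the product of the two Jacobians is the identity; this gives the
   full rank of [g]. *)
have Nr : \forall u \near c y, id u = chart_rep (g \o f) c c u.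
  have oV : open (c @` (cdom c `&` V)) by apply: cimgI_open; exact: cinv_image_open.
  have yV : (c @` (cdom c `&` V)) (c y) by exists y.
  apply: filterS (open_nbhs_nbhs (conj oV yV)) => _ [z [cz Vz] <-].
  by rewrite /chart_rep /= cfunK// gf.
have [|_ E'] := near_eq_jacobian Nr.
  apply: (@smooth_on_diff R n n setT) => //.
  by apply: smooth_on_id; exact: openT.
have E2 := etrans (esym E) (etrans E' (jacobian_id _)).
have [_ u2] := mulmx1_unit E2.
apply: (has_rank_intro Ad Ac (Vd _ Vy)); first by rewrite gf.
by apply/eqP; rewrite -/(row_free _) row_free_unit.
Qed.

End SmoothAtTheory.

(** * Open submanifolds *)

Section Topo.

Lemma near_eq_continuous (S T : topologicalType) (f g : S -> T) (x : S) :
  (\forall y \near x, f y = g y) -> {for x, continuous f} -> {for x, continuous g}.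
Proof.
move=> fg cf; have fgx := nbhs_singleton fg.
move=> A; rewrite -fgx => /cf H; apply: (@filterS2 _ (nbhs x) _ _ _ _ _ fg H).
by move=> y /= <-.
Qed.

Lemma continuous_into_set_type (S T : topologicalType) (U : set T) (g : S -> set_type U) x :
  {for x, continuous (set_val \o g)} -> {for x, continuous g}.
Proof.
move=> cg A; rewrite nbhsE => -[Q [[B oB BO] Qg] QA].
have : nbhs (set_val (g x)) B by apply: open_nbhs_nbhs; split=> //; move: Qg; rewrite -BO.
move=> /cg H; apply: (@filterS _ (nbhs x) _ ((set_val \o g) @^-1` B)) => //.
by move=> y /= By; apply: QA; rewrite -BO.
Qed.

Lemma set_val_continuous (T : topologicalType) (U : set T) : continuous (set_val : U -> T).
Proof. exact: initial_continuous. Qed.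

Lemma set_val_inj (T : Type) (U : set T) : injective (set_val : U -> T).
Proof. by move=> x y; rewrite set_valE; exact: val_inj. Qed.

Lemma set_val_in (T : Type) (U : set T) (x : U) : U (set_val x).
Proof. by rewrite set_valE; exact: set_valP. Qed.

Lemma topological_embedding_val (T : topologicalType) (U : set T) :
  topological_embedding (set_val : U -> T).
Proof.
split; [exact: set_val_inj|exact: set_val_continuous|].
by move=> A [B oB <-]; exists B.
Qed.

Lemma topological_embedding_comp (S T V : topologicalType) (f : S -> T) (g : T -> V) :
  topological_embedding f -> topological_embedding g -> topological_embedding (g \o f).
Proof.
move=> [fi fc fo] [gi gc go]; split.
- by move=> x y /gi/fi.
- by move=> x; apply: continuous_comp; [exact: fc|exact: gc].
- move=> A /fo[B /go[C oC ->] ->]; by exists C.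
Qed.

Lemma topological_embedding_lift (S T : topologicalType) (U : set T) (f : S -> set_type U) :
  topological_embedding (set_val \o f) -> topological_embedding f.
Proof.
move=> [fi fc fo]; split.
- by move=> x y fxy; apply: fi; rewrite /= fxy.
- by move=> x; apply: continuous_into_set_type; exact: fc.
- move=> A /fo[B oB ->]; exists (set_val @^-1` B) => //.
  by exists B.
Qed.

Lemma embedding_hausdorff (S T : topologicalType) (f : S -> T) :
  injective f -> continuous f -> hausdorff_space T -> hausdorff_space S.
Proof.
move=> fi fc hT x y xy; apply: fi; apply: hT => A B Ax By.
by have [z [Az Bz]] := xy _ _ (fc _ _ Ax) (fc _ _ By); exists (f z).
Qed.

Lemma sub_second_countable (T : topologicalType) (U : set T) :
  @second_countable T -> @second_countable (set_type U).
Proof.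
move=> [B cB [oB bB]]; exists [set set_val @^-1` b | b in B].
  by apply: sub_countable cB; exact: card_image_le.
split.
  by move=> _ [b Bb <-]; exists b => //; exact: oB.
move=> x A; rewrite nbhsE => -[Q [[C oC CO] Qx] QA].
have : nbhs (set_val x) C by apply: open_nbhs_nbhs; split=> //; move: Qx; rewrite -CO.
move=> /bB[b [Bb bx] bC].
exists (set_val @^-1` b); first by split=> //; exists b.
by move=> y /= /bC Cy; apply: QA; rewrite -CO.
Qed.

End Topo.

Section OpenSub.
Context {R : realType} {n : nat} {M : manifold R n} (U : set M).
Hypothesis oU : open U.

Lemma val_insubd_set (u0 : U) x : U x -> set_val (insubd u0 x) = x.
Proof. by move=> Ux; rewrite set_valE val_insubd mem_set. Qed.

Section Restr.
Variables (c : mchart R n M) (u0 : U).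

Let rdom : set (set_type U) := set_val @^-1` cdom c.
Let rfun (x : set_type U) := c (set_val x).
Let rinv (v : 'rV[R]_n) : set_type U := insubd u0 (cinv c v).

Let rimg : rfun @` rdom = c @` (cdom c `&` U).
Proof.
apply/seteqP; split=> [_ [x dx <-]|_ [x [dx Ux] <-]].
  by exists (set_val x) => //; split=> //; exact: set_val_in.
by exists (insubd u0 x); rewrite /rdom /rfun /= val_insubd_set.
Qed.

Let rdom_open : open rdom.
Proof. by exists (cdom c) => //; exact: cdom_open. Qed.

Let rimg_open : open (rfun @` rdom).
Proof. by rewrite rimg; exact: cimgI_open. Qed.

Let rfunK x : rdom x -> rinv (rfun x) = x.
Proof.
by move=> dx; apply: set_val_inj; rewrite /rinv /rfun cfunK// val_insubd_set//; exact: set_val_in.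
Qed.

Let rfun_cont : {within rdom, continuous rfun}.
Proof.
rewrite continuous_open_subspace//; move=> x; rewrite inE => dx.
apply: continuous_comp; first exact: set_val_continuous.
exact: cfun_cont.
Qed.

Let rinv_cont : {within rfun @` rdom, continuous rinv}.
Proof.
rewrite continuous_open_subspace//; move=> v; rewrite inE rimg => -[x [dx Ux] xv].
apply: continuous_into_set_type.
have xv' : cimg c v by exists x.
have E : \forall w \near v, cinv c w = (set_val \o rinv) w.
  have oW := @cimgI_open _ _ _ c _ oU.
  have Wv : (c @` (cdom c `&` U)) v by exists x.
  apply: filterS (open_nbhs_nbhs (conj oW Wv)) => _ [y [dy Uy] <-].
  by rewrite /rinv /= cfunK// val_insubd_set.
exact: near_eq_continuous E (cinv_cont xv').
Qed.

(** The point [u0] supplies the values of the inverse chart where it would leave [U]. The atlas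
    admits every [u0], and is empty when [U] is. *)
Definition restr_chart : mchart R n (set_type U) :=
  MChart rdom_open rimg_open rfunK rfun_cont rinv_cont.

End Restr.

Definition opensub_atlas : set (mchart R n (set_type U)) :=
  [set e | exists c u0, matlas c /\ e = restr_chart c u0].

Lemma opensub_cover x : exists2 e, opensub_atlas e & cdom e x.
Proof.
have [c Ac cx] := matlas_cover (set_val x).
by exists (restr_chart c x) => //; exists c, x.
Qed.

Lemma opensub_compat c d : opensub_atlas c -> opensub_atlas d ->
  smooth_on (c @` (cdom c `&` cdom d)) (d \o cinv c).
Proof.
move=> [c' [u [Ac ->]]] [d' [v [Ad ->]]].
set W := _ @` _.
have WE : W = c' @` (cdom c' `&` (cdom d' `&` U)).
  apply/seteqP; split=> [_ [x [dx d'x] <-]|_ [x [dx [d'x Ux]] <-]].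
    by exists (set_val x) => //; do 2!split=> //; exact: set_val_in.
  by exists (insubd u x); rewrite /= /preimage /= val_insubd_set.
have oW : open W by rewrite WE; apply: cimgI_open; apply: openI => //; exact: cdom_open.
apply: (@smooth_on_ext _ _ _ W (d' \o cinv c')) => //.
  rewrite WE => _ [x [dx [d'x Ux]] <-].
  by rewrite /= cfunK// val_insubd_set.
apply: smooth_on_sub (matlas_compat Ac Ad).
by rewrite WE => _ [x [dx [d'x Ux]] <-]; exists x.
Qed.

Definition opensub : manifold R n :=
  @Manifold R n (set_type U)
    (embedding_hausdorff (@set_val_inj _ U) (@set_val_continuous _ U) (@mspace_hausdorff _ _ M))
    (sub_second_countable U (@mspace_second_countable _ _ M))
    opensub_atlas opensub_cover opensub_compat.

End OpenSub.

Section OpenSubTheory.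
Context {R : realType}.

Lemma smooth_at_val n (M : manifold R n) (U : set M) (oU : open U) (x : opensub oU) :
  smooth_at (set_val : opensub oU -> M) x /\ has_rank (set_val : opensub oU -> M) x n.
Proof.
have [c Ac cx] := matlas_cover (set_val x).
pose e : mchart R n (opensub oU) := restr_chart oU c x.
have Ae : matlas e by exists c, x.
pose f : opensub oU -> M := set_val.
have ex : cdom e x by [].
have cfx : cdom c (f x) by [].
pose W := c @` (cdom c `&` U).
have oW : open W by exact: cimgI_open.
have WE u : W u -> [/\ U (cinv c u), c (cinv c u) = u & cdom c (cinv c u)].
  by move=> [y [cy Uy] <-]; rewrite cfunK.
have Wx : W (e x) by exists (set_val x) => //; split=> //; exact: set_val_in.
have E u : W u -> id u = chart_rep f e c u.
  by move=> /WE[Uu uE _]; rewrite /chart_rep /f /= val_insubd_set.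
have s : smooth_in f x e c.
  split=> //; exists W; split=> //.
  - move=> u /WE[Uu uE cu]; exists (insubd x (cinv c u)).
      by rewrite /= /preimage /= val_insubd_set.
    by rewrite /= val_insubd_set.
  - by move=> u /WE[Uu uE cu]; rewrite /f /= val_insubd_set.
  - exact: (smooth_on_ext oW E (smooth_on_id oW)).
split; first by exists e, c.
apply: (has_rank_intro Ae Ac ex cfx).
have Nr : \forall u \near e x, id u = chart_rep f e c u.
  by apply: filterS (open_nbhs_nbhs (conj oW Wx)).
have [_ E'] := near_eq_jacobian Nr (smooth_on_diff (smooth_on_id oW) Wx).
apply: (etrans (congr1 (fun A => \rank A) (etrans E' (jacobian_id _)))).
exact: mxrank1.
Qed.

Lemma smooth_at_lift m n (M : manifold R m) (N : manifold R n) (U : set N) (oU : open U)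
    (f : M -> opensub oU) (x : M) :
  smooth_at (set_val \o f : M -> N) x ->
  smooth_at f x /\ forall r, has_rank (set_val \o f : M -> N) x r -> has_rank f x r.
Proof.
move=> [c [d [Ac Ad cx dx [W [oW Wx Wc Wd sW]]]]]; split.
  exists c, (restr_chart oU d (f x)); split=> //; first by exists d, (f x).
  by exists W.
move=> r [c' [d' [Ac' Ad' cx' dx' rk]]].
have A : matlas (restr_chart oU d' (f x) : mchart R n (opensub oU)) by exists d', (f x).
exact: (has_rank_intro Ac' A cx' dx' rk).
Qed.

Lemma smooth_embeddingP m n (M : manifold R m) (N : manifold R n) (f : M -> N) :
  smooth_embedding f <-> (forall x, smooth_at f x /\ has_rank f x m) /\ topological_embedding f.
Proof.
split.
  by move=> [/smooth_mapP sf rf tf]; split.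
by move=> [H tf]; split=> //; [apply/smooth_mapP => x|move=> x]; have [] := H x.
Qed.

Lemma smooth_embedding_comp m n p (M : manifold R m) (N : manifold R n) (P : manifold R p)
    (f : M -> N) (g : N -> P) :
  smooth_embedding f -> smooth_embedding g -> smooth_embedding (g \o f).
Proof.
move=> /smooth_embeddingP[Hf tf] /smooth_embeddingP[Hg tg]; apply/smooth_embeddingP.
split; last exact: topological_embedding_comp.
move=> x; have [sf rf] := Hf x; have [sg rg] := Hg (f x).
by split; [exact: smooth_at_comp|exact: immersion_comp].
Qed.

Lemma smooth_embedding_val n (M : manifold R n) (U : set M) (oU : open U) :
  smooth_embedding (set_val : opensub oU -> M).
Proof.
apply/smooth_embeddingP; split; last exact: topological_embedding_val.
by move=> x; exact: smooth_at_val.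
Qed.

Lemma smooth_embedding_lift m n (M : manifold R m) (N : manifold R n) (U : set N) (oU : open U)
    (f : M -> opensub oU) :
  smooth_embedding (set_val \o f : M -> N) -> smooth_embedding f.
Proof.
move=> /smooth_embeddingP[H tf]; apply/smooth_embeddingP.
split; last exact: topological_embedding_lift.
by move=> x; have [s r] := H x; have [s' r'] := smooth_at_lift s; split=> //; exact: r'.
Qed.

Lemma smooth_embedding_id n (M : manifold R n) : smooth_embedding (id : M -> M).
Proof.
apply/smooth_embeddingP; split=> [x|]; first exact: smooth_at_id.
by split=> [x y|x|A oA] //; exists A.
Qed.

(** * Local connectedness and local compactness of manifolds *)

Lemma ball_connected n (x : 'rV[R]_n) (r : R) : 0 < r ->
  connected [set y : 'rV[R]_n | `|y - x| < r].
Proof.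
move=> r0.
have -> : [set y : 'rV[R]_n | `|y - x| < r] =
    \bigcup_(y in [set y : 'rV[R]_n | `|y - x| < r]) ((fun t : R => x + t *: (y - x)) @` `[0, 1]).
  apply/seteqP; split=> [y yr|_ [y yr [t t01 <-]]].
    exists y => //; exists 1; first by rewrite /= in_itv /= ler01 lexx.
    by rewrite scale1r addrC subrK.
  move: t01; rewrite /= in_itv /= => /andP[t0 t1].
  rewrite addrAC subrr add0r normrZ ger0_norm//.
  by apply: le_lt_trans yr; rewrite ler_piMl.
apply: bigcup_connected.
  exists x => y _; exists 0; first by rewrite /= in_itv /= ler01 lexx.
  by rewrite scale0r addr0.
move=> y _; apply: connected_continuous_connected; first exact: segment_connected.
apply: continuous_subspaceT => t.
apply: (@continuousD R _ _ (cst x) (fun t : R => t *: (y - x)) t); first exact: cst_continuous.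
exact: continuousZr_tmp.
Qed.

Lemma chart_ball n (M : manifold R n) (x : M) (U : set M) : open U -> U x ->
  exists c (r : R), [/\ matlas c, cdom c x, 0 < r &
    forall u : 'rV[R]_n, `|u - c x| < r -> (c @` (cdom c `&` U)) u].
Proof.
move=> oU Ux; have [c Ac cx] := matlas_cover x.
have oW := @cimgI_open _ _ _ c _ oU.
have Wx : (c @` (cdom c `&` U)) (c x) by exists x.
have /nbhs_normP[r /= r0 H] := open_nbhs_nbhs (conj oW Wx).
by exists c, r; split=> // u ur; apply: H; rewrite /ball_ /= distrC.
Qed.

Lemma manifold_locally_connected n (M : manifold R n) (x : M) (U : set M) : open U -> U x ->
  exists V, [/\ open V, V x, V `<=` U & connected V].
Proof.
move=> oU Ux; have [c [r [Ac cx r0 H]]] := chart_ball oU Ux.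
pose B := [set u : 'rV[R]_n | `|u - c x| < r].
have oB : open B.
  have -> : B = ball (c x) r.
    by rewrite -ball_normE; apply/seteqP; split=> a; rewrite /B /ball_ /= distrC.
  exact: ball_open.
have E : cdom c `&` c @^-1` B = cinv c @` B.
  apply/seteqP; split=> [y [cy By]|_ [u Bu <-]]; first by exists (c y) => //; rewrite cfunK.
  have [y [cy Uy] yu] := H _ Bu; rewrite -yu cfunK//; split=> //.
  by rewrite /preimage /mkset yu.
exists (cdom c `&` c @^-1` B); split.
- exact: cinv_image_open.
- by split=> //; rewrite /preimage /mkset /B /= subrr normr0.
- by rewrite E => _ [u /H[y [cy Uy] <-] <-]; rewrite cfunK.
- rewrite E; apply: connected_continuous_connected; first exact: ball_connected.
  apply: continuous_in_subspaceT => u; rewrite inE => /H[y [cy Uy] <-].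
  by apply: cinv_cont; exact: cimg_in.
Qed.

Lemma manifold_locally_compact n (M : manifold R n) (x : M) (U : set M) : open U -> U x ->
  exists K, [/\ compact K, nbhs x K & K `<=` U].
Proof.
move=> oU Ux; have [c [r [Ac cx r0 H]]] := chart_ball oU Ux.
pose B := [set u : 'rV[R]_n | `|u - c x| <= r / 2].
have rr : r / 2 < r by lra.
have Br u : B u -> `|u - c x| < r by move=> /le_lt_trans; apply.
have cB : compact B.
  apply: bounded_closed_compact.
    exists (r / 2 + `|c x|); split; first exact: num_real.
    move=> t rt u Bu; apply: le_trans (ltW rt).
    by rewrite -(subrK (c x) u); apply: le_trans (ler_normD _ _) _; rewrite lerD2r.
  have -> : B = closed_ball_ (fun z => `|z|) (c x) (r / 2).
    by apply/seteqP; split=> a; rewrite /B /closed_ball_ /= distrC.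
  exact: closed_closed_ball_.
exists (cinv c @` B); split.
- apply: continuous_compact => //.
  apply: continuous_in_subspaceT => u; rewrite inE => /Br/H[y [cy Uy] <-].
  by apply: cinv_cont; exact: cimg_in.
- have oB : open (ball (c x) (r / 2)) by apply: ball_open; rewrite divr_gt0.
  have xB : (cdom c `&` c @^-1` (ball (c x) (r / 2))) x.
    by split=> //; apply: ballxx; rewrite divr_gt0.
  apply: filterS (open_nbhs_nbhs (conj (cinv_image_open c oB) xB)) => y [cy].
  rewrite /preimage /mkset -ball_normE /ball_ /= => yB.
  by exists (c y); [rewrite /B /= distrC ltW|rewrite cfunK].
- by move=> _ [u /Br/H[y [cy Uy] <-] <-]; rewrite cfunK.
Qed.

Lemma manifold_component_open n (M : manifold R n) (U : set M) (x : M) : open U ->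
  open (connected_component U x).
Proof.
move=> oU; rewrite openE => y cy.
have Uy := connected_component_sub cy.
have [V [oV Vy VU cV]] := manifold_locally_connected oU Uy.
have Vn : nbhs y V by exact: open_nbhs_nbhs.
apply: filterS Vn => z Vz; apply: connected_component_trans cy _.
by exists V.
Qed.

End OpenSubTheory.

(** * Finite group actions *)

Section JacMore.
Context {R : realType}.

Lemma jacobian_sum m n N (F : 'I_N -> 'rV[R]_m -> 'rV[R]_n) (x : 'rV[R]_m) :
  (forall j, differentiable (F j) x) ->
  differentiable (fun u => \sum_j F j u) x /\
  jacobian (fun u => \sum_j F j u) x = \sum_j jacobian (F j) x.
Proof.
move=> dF.
have E : (fun u => \sum_j F j u) = \sum_j F j by rewrite fct_sumE.
have dS : differentiable (\sum_j F j) x by exact: differentiable_sum.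
split; first by rewrite E.
apply/row_matrixP => i; rewrite !rowE E mulmx_sumr.
apply: (etrans (esym (deriveEjacobian _ dS))).
rewrite derive_sum; last by move=> j; exact: diff_derivable.
apply: eq_bigr => j _; exact: deriveEjacobian.
Qed.

Lemma jacobian_near_eq m n (M : manifold R m) (N : manifold R n) (f g : M -> N) (x : M) c d :
  smooth_in f x c d -> (\forall y \near x, f y = g y) ->
  jacobian (chart_rep g c d) (c x) = jacobian (chart_rep f c d) (c x).
Proof.
move=> [Ac Ad cx dx [U [oU Ux Uc Ud sU]]] fg.
have Nr : \forall u \near c x, chart_rep f c d u = chart_rep g c d u.
  move: fg; rewrite /prop_near1 nbhsE => -[V [oV Vx] VE].
  have oW := @cimgI_open _ _ _ c _ oV.
  have Wx : (c @` (cdom c `&` V)) (c x) by exists x.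
  apply: filterS (open_nbhs_nbhs (conj oW Wx)) => _ [y [cy Vy] <-].
  by rewrite /chart_rep /= (cfunK cy) VE.
by have [_ ->] := near_eq_jacobian Nr (smooth_on_diff sU Ux).
Qed.

Lemma jacobian_cont m n (M : manifold R m) (N : manifold R n) (f : M -> N) (x : M) c d l j :
  smooth_in f x c d -> {for x, continuous (fun y => jacobian (chart_rep f c d) (c y) l j)}.
Proof.
move=> [Ac Ad cx dx [U [oU Ux Uc Ud sU]]].
apply: (@continuous_comp _ _ _ c (fun u => jacobian (chart_rep f c d) u l j)).
  exact: cfun_cont.
have [df cf] := (smooth_onE _ _).1 sU 1%N.
have H := (Ckg0P _ oU).1 (cf (delta_mx 0 l)) _ Ux.
have E : \forall u \near c x,
    'D_(delta_mx 0 l) (chart_rep f c d) u 0 j = jacobian (chart_rep f c d) u l j.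
  apply: filterS (open_nbhs_nbhs (conj oU Ux)) => u Uu.
  have := deriveEjacobian (delta_mx 0 l) (df _ Uu) => ->.
  by rewrite -rowE mxE.
apply: near_eq_continuous E _.
exact: (continuous_comp H (@coord_continuous _ _ _ _ _ _)).
Qed.

Lemma smooth_in_near m n (M : manifold R m) (N : manifold R n) (f : M -> N) (x : M) c d :
  smooth_in f x c d -> \forall y \near x, smooth_in f y c d.
Proof.
move=> [Ac Ad cx dfx [U [oU Ux Uc Ud sU]]].
apply: filterS (open_nbhs_nbhs (conj (cinv_image_open c oU) (conj cx Ux))) => y [cy Uy].
split=> //; last by exists U.
by have := Ud _ Uy; rewrite cfunK.
Qed.

Lemma neq_near (T : topologicalType) (F G : T -> R) (x : T) :
  {for x, continuous F} -> {for x, continuous G} -> F x <> G x -> \forall y \near x, F y <> G y.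
Proof.
move=> cF cG FG.
have ch : {for x, continuous (fun y => F y - G y)} by exact: continuousB.
have hx : F x - G x != 0 by rewrite subr_eq0; apply/eqP.
have := ch _ (open_nbhs_nbhs (conj (@open_neq _ (0 : R)) hx)).
apply: (@filterS _ (nbhs x)) => y /= + FGy.
by rewrite FGy subrr eqxx.
Qed.

(** Used by contraposition: Jacobian entries are continuous, so a limit of points near which [f] and
    [g] coincide is a point where their Jacobians agree. *)
Lemma jacobian_neq_near m n (M : manifold R m) (N : manifold R n) (f g : M -> N) (x : M) c d :
  smooth_in f x c d -> smooth_in g x c d ->
  jacobian (chart_rep f c d) (c x) <> jacobian (chart_rep g c d) (c x) ->
  \forall y \near x, ~ (\forall z \near y, f z = g z).
Proof.
move=> sf sg /matrixP/existsNP[l /existsNP[j lj]].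
have cf := @jacobian_cont _ _ _ _ _ _ _ _ l j sf; have cg := @jacobian_cont _ _ _ _ _ _ _ _ l j sg.
have Hn := neq_near cf cg lj.
apply: filterS2 Hn (smooth_in_near sf) => y nz sfy E.
apply: nz; exact: (congr1 (fun A : 'M[R]_(m, n) => A l j) (esym (jacobian_near_eq sfy E))).
Qed.

End JacMore.

Section GMan.
Context {R : realType} {n : nat} {G : finGroupType} {M : gmanifold R n G}.
Implicit Types (g h : G) (x : M).

Lemma gactK g x : gact g^-1%g (gact g x) = x.
Proof. by rewrite -gactM mulVg gact1. Qed.

Lemma gactVK g x : gact g (gact g^-1%g x) = x.
Proof. by rewrite -gactM mulgV gact1. Qed.

Lemma gact_inj g : injective (gact g : M -> M).
Proof. by move=> x y /(congr1 (gact g^-1%g)); rewrite !gactK. Qed.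

Lemma gact_smooth_at g x : smooth_at (gact g : M -> M) x.
Proof. by move: x; apply/smooth_mapP; exact: gact_smooth. Qed.

Lemma gact_cont g : continuous (gact g : M -> M).
Proof. by have [] := @gact_smooth _ _ _ M g. Qed.

Lemma gact_rank g x : has_rank (gact g : M -> M) x n.
Proof.
have [c Ac cx] := matlas_cover x.
have [d Ad dx] := matlas_cover (gact g x).
have sg := smooth_at_in (gact_smooth_at g x) Ac Ad cx dx.
have cx' : cdom c (gact g^-1%g (gact g x)) by rewrite gactK.
have sv := smooth_at_in (gact_smooth_at g^-1 (gact g x)) Ad Ac dx cx'.
have [sid E] := smooth_in_comp sg sv.
have [s1 r1] := smooth_at_id x.
have F : \forall y \near x, (fun y : M => y) y = (gact g^-1%g \o gact g) y.
  by near=> y; rewrite /= gactK.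
have [_ /(_ _ r1) rk] := smooth_at_ext s1 F.
have {}rk := has_rankP sid rk.
apply: (has_rank_intro Ac Ad cx dx); apply/eqP; rewrite eqn_leq rank_leq_row /=.
apply: leq_trans (mxrankM_maxl _ (jacobian (chart_rep (gact g^-1%g : M -> M) d c) (d (gact g x)))).
by apply: eq_leq; apply: esym; exact: etrans (esym (congr1 (fun A => \rank A) E)) rk.
Unshelve. all: by end_near. Qed.

Lemma smooth_embedding_gact g : smooth_embedding (gact g : M -> M).
Proof.
apply/smooth_embeddingP; split=> [x|]; first by split; [exact: gact_smooth_at|exact: gact_rank].
split; [exact: gact_inj|exact: gact_cont|].
move=> A oA; exists (gact g^-1%g @^-1` A).
  by have /continuousP := @gact_cont g^-1%g; apply.
by apply/seteqP; split=> x; rewrite /preimage /mkset gactK.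
Qed.

(* The finite sum of the translates of a chart by the powers of [g] is invariant under [g]
   and, where [g] has the derivative of the identity along [i], still an immersion. *)
Lemma fixed_near_of_derivative k (S : manifold R k) (i : S -> M) g (a : S)
    (c : mchart R k S) (e : mchart R n M) :
  smooth_embedding i -> (forall s, exists t, i t = gact g (i s)) ->
  smooth_in i a c e -> gact g (i a) = i a ->
  jacobian (chart_rep (gact g \o i : S -> M) c e) (c a) = jacobian (chart_rep i c e) (c a) ->
  \forall s \near a, gact g (i s) = i s.
Proof.
move=> /smooth_embeddingP[Hi [inj_i ci emb_i]] gi sie gia Jg.
have [Ac Ae ca ea _] := sie.
have gja j : gact (g ^+ j)%g (i a) = i a.
  elim: j => [|j IH]; first by rewrite expg0 gact1.
  by rewrite expgS gactM IH.
(* By induction on [j], every power of [g] has the derivative of the identity along [i] at [a]. *)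
have Js j : smooth_in (gact (g ^+ j)%g \o i : S -> M) a c e /\
   jacobian (chart_rep (gact (g ^+ j)%g \o i : S -> M) c e) (c a) =
   jacobian (chart_rep i c e) (c a).
  have ega h : gact h (i a) = i a -> smooth_in (gact h : M -> M) (i a) e e.
    move=> hia; apply: (smooth_at_in _ Ae Ae ea); first exact: gact_smooth_at.
    by rewrite hia; exact: ea.
  have [_ Eg] := smooth_in_comp sie (ega _ gia).
  have [sj Ej] := smooth_in_comp sie (ega _ (gja j)).
  split; first exact: sj.
  elim: j sj Ej => [|j IH] sj Ej.
    apply: jacobian_near_eq sie _.
    by near=> y; rewrite /= expg0 gact1.
  have [sj' Ej'] := smooth_in_comp sie (ega _ (gja j)).
  have sg' : smooth_in (gact g : M -> M) ((gact (g ^+ j)%g \o i : S -> M) a) e e.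
    by rewrite /= gja; exact: ega.
  have [sgj Egj] := smooth_in_comp sj' sg'.
  have F : \forall y \near a,
      (gact g \o (gact (g ^+ j)%g \o i) : S -> M) y = (gact (g ^+ j.+1)%g \o i : S -> M) y.
    by near=> y; rewrite /= expgS gactM.
  apply: (etrans (jacobian_near_eq sgj F)); apply: (etrans Egj).
  have ea' : e ((gact (g ^+ j)%g \o i) a) = e (i a) by rewrite /= gja.
  apply: (etrans (congr1 (mulmx^~ _) (IH sj' Ej'))).
  apply: (etrans (congr1 (fun z => jacobian (chart_rep i c e) (c a) *m
    jacobian (chart_rep (gact g : M -> M) e e) z) ea')).
  exact: (etrans (esym Eg) Jg).
have rk := has_rankP sie (Hi a).2.
pose N := #[g]%g.
have N0 : (0 < N)%N by exact: order_gt0.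
pose F j := chart_rep (gact (g ^+ j)%g \o i : S -> M) c e.
pose H u := \sum_(j < N) F j u.
have [U [oU Ua UF]] : exists U, [/\ open U, U (c a) & forall j : 'I_N, smooth_on U (F j)].
  have sN (j : 'I_N) : \forall u \near c a, exists W, [/\ open W, W u & smooth_on W (F j)].
    have [[_ _ _ _ [W [oW Wa _ _ sW]]] _] := Js j.
    apply: filterS (open_nbhs_nbhs (conj oW Wa)) => u Wu.
    by exists W; split; [exact: oW|exact: Wu|exact: sW].
  have := nbhs_forall sN.
  rewrite nbhsE => -[U [oU Ua] UH].
  exists U; split; [exact: oU|exact: Ua|].
  move=> j; apply/smooth_onE => q; apply: (Ckg_local oU).
  move=> u Uu; have [W [oW Wu sW]] := UH _ Uu j.
  by exists W; split; [exact: oW|exact: Wu|exact: (smooth_onE _ _).1 sW q].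
have CH : Ckg 1 U H.
  by apply: (Ckg_sum _ (P := xpredT) oU) => j _; exact: (smooth_onE _ _).1 (UF j) 1%N.
have [dH JH] := jacobian_sum (fun j => smooth_on_diff (UF j) Ua).
have rH : row_free (jacobian H (c a)).
  have E : jacobian H (c a) = N%:R *: jacobian (chart_rep i c e) (c a).
    apply: (etrans JH).
    have -> : \sum_(j < N) jacobian (F j) (c a) = \sum_(j < N) jacobian (chart_rep i c e) (c a).
      by apply: eq_bigr => j _; exact: (Js j).2.
    by rewrite sumr_const card_ord scaler_nat.
  rewrite /row_free; apply/eqP; apply: (etrans (congr1 (fun A => \rank A) E)).
  apply: etrans rk; apply: mxrank_scale_nz; rewrite pnatr_eq0 -lt0n; exact: N0.
have [r r0 [C C0 [rU L _]]] := immersion_nbhs oU Ua CH rH.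
pose B := cdom c `&` c @^-1` ball (c a) r.
have oB : open B by apply: cinv_image_open; exact: ball_open.
have Ba : B a by split; [exact: ca|exact: ballxx].
have BE y : B y -> `|c y - c a| < r.
  by move=> [_]; rewrite /preimage /mkset -ball_normE /ball_ /= distrC.
(* The point [t] with [i t = g (i s)] is close to [a] only because [i] is a topological embedding
   and [g (i s)] is close to [i a]. *)
have [B' oB' BB'] := emb_i _ oB.
have B'a : nbhs (i a) B'.
  by apply: open_nbhs_nbhs; split; [exact: oB'|move: Ba; rewrite BB'; exact].
have cg : {for a, continuous (gact g \o i : S -> M)}.
  by apply: continuous_comp; [exact: ci|exact: gact_cont].
have N1 : nbhs a (fun s => B' (gact g (i s))).
  by apply: (cg B'); rewrite /= gia.
apply: (@filterS2 _ (nbhs a) _ _ _ _ _ (open_nbhs_nbhs (conj oB Ba)) N1) => s Bs B's.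
have [t tE] := gi s.
have Bt : B t by rewrite BB' /preimage /mkset tE.
(* Applying [g] shifts the summands by one, and the term of index [N] is that of index 0 because [N]
   is the order of [g]. Injectivity of [H] near [c a] then gives [t = s]. *)
have Hst : H (c t) = H (c s).
  have [cs _] := Bs; have [ct _] := Bt.
  have FE j : F j (c t) = F j.+1 (c s).
    by rewrite /F /chart_rep /= (cfunK ct) (cfunK cs) tE -gactM expgSr.
  have FN : F N (c s) = F 0%N (c s).
    by rewrite /F /chart_rep /= expg_order expg0.
  have E1 : \sum_(j < N.+1) F j (c s) = F 0%N (c s) + H (c t).
    by rewrite big_ord_recl; congr (_ + _); apply: eq_bigr => j _; rewrite FE.
  have E2 : \sum_(j < N.+1) F j (c s) = H (c s) + F 0%N (c s).
    by rewrite big_ord_recr /= FN.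
  by apply: (addrI (F 0%N (c s))); rewrite -E1 E2 addrC.
have := L _ _ (BE _ Bs) (BE _ Bt).
rewrite Hst subrr normr0 mulr0 normr_le0 subr_eq0 => /eqP /(congr1 (cinv c)).
by rewrite (cfunK Bs.1) (cfunK Bt.1) => ts; rewrite -tE ts.
Unshelve. all: by end_near. Qed.

End GMan.

Lemma hausdorff_neq_near (S T : topologicalType) (f g : S -> T) (x : S) :
  hausdorff_space T -> {for x, continuous f} -> {for x, continuous g} -> f x <> g x ->
  \forall y \near x, f y <> g y.
Proof.
move=> hT cf cg /eqP fg.
move: hT; rewrite open_hausdorff => /(_ _ _ fg)[[A B] /= [fA gB] [oA oB /eqP AB]].
have NA : nbhs (f x) A by apply: open_nbhs_nbhs; split=> //; exact: set_mem.
have NB : nbhs (g x) B by apply: open_nbhs_nbhs; split=> //; exact: set_mem.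
apply: (@filterS2 _ (nbhs x) _ _ _ _ _ (cf _ NA) (cg _ NB)) => y /= Ay By fgy.
have : (A `&` B) (f y) by split=> //; rewrite fgy.
by rewrite AB.
Qed.

Lemma nbhs_setI (T : topologicalType) (x : T) (A B : set T) :
  nbhs x A -> nbhs x B -> nbhs x (A `&` B).
Proof. exact: filterI. Qed.

Lemma connected_clopen (T : topologicalType) (A : set T) :
  connected [set: T] -> open A -> closed A -> A !=set0 -> A = setT.
Proof.
move=> cT oA cA A0; apply: cT => //.
  by exists A => //; rewrite setTI.
by exists A => //; rewrite setTI.
Qed.

Section GMan2.
Context {R : realType} {n : nat} {G : finGroupType} {M : gmanifold R n G}.
Implicit Types (g h : G) (x : M).

(** The interior of the fixed set is closed: at a limit point the values agree as the space is
    Hausdorff, the Jacobians agree by continuity, and [fixed_near_of_derivative] applies.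
    Connectedness of [S] concludes. *)
Lemma fixed_of_open k (S : manifold R k) (i : S -> M) g (A : set S) :
  smooth_embedding i -> (forall s, exists t, i t = gact g (i s)) -> connected [set: S] ->
  open A -> A !=set0 -> (forall s, A s -> gact g (i s) = i s) -> forall s, gact g (i s) = i s.
Proof.
move=> si gi cS oA A0 gA.
have /smooth_embeddingP[Hi [inj_i ci emb_i]] := si.
pose B := interior [set s | gact g (i s) = i s].
suff BT : B = setT.
  by move=> s; have /interior_subset : B s by rewrite BT.
have cg : continuous (gact g \o i : S -> M).
  by move=> s; apply: continuous_comp; [exact: ci|exact: gact_cont].
apply: connected_clopen => //.
- exact: open_interior.
- move=> a aB.
  have gia : gact g (i a) = i a.
    apply: contrapT => ne.
    have N := hausdorff_neq_near (@mspace_hausdorff _ _ M) (cg a) (ci a) ne.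
    by have [b [/interior_subset/= Eb]] := aB _ N.
  have [c Ac ca] := matlas_cover a.
  have [e Ae ea] := matlas_cover (i a).
  have sia := smooth_at_in (Hi a).1 Ac Ae ca ea.
  have sga : smooth_in (gact g \o i : S -> M) a c e.
    apply: (smooth_at_in _ Ac Ae ca); last by rewrite /= gia.
    by apply: smooth_at_comp; [exact: (Hi a).1|exact: gact_smooth_at].
  apply: (fixed_near_of_derivative si gi sia gia).
  apply: contrapT => ne.
  have [b [Bb nb]] := aB _ (jacobian_neq_near sga sia ne).
  exact: nb.
- have [a Aa] := A0; exists a.
  by apply: filterS (open_nbhs_nbhs (conj oA Aa)).
Qed.

(** A priori different group elements may serve on different pieces accumulating at [a]. Each of
    them has the 1-jet of [phi] at [a], and any two such elements coincide near [a], so one element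
    serves on all pieces. *)
Lemma locally_group_element (phi : M -> M) (a : M) : smooth_at phi a ->
  (\forall x \near a, exists g : G, phi x = gact g x) ->
  exists g : G, \forall x \near a, phi x = gact g x.
Proof.
move=> sp H.
have [c Ac ca] := matlas_cover a.
have [d Ad da] := matlas_cover (phi a).
have spa := smooth_at_in sp Ac Ad ca da.
(* The elements with the 1-jet of [phi] at [a]. By [N1] below the others agree with [phi] on no open
   set near [a]; by [N2] those in [T] coincide near [a]. *)
pose T g := phi a = gact g a /\
  jacobian (chart_rep phi c d) (c a) = jacobian (chart_rep (gact g : M -> M) c d) (c a).
have sga g : phi a = gact g a -> smooth_in (gact g : M -> M) a c d.
  move=> E; apply: (smooth_at_in _ Ac Ad ca); first exact: gact_smooth_at.
  by rewrite -E; exact: da.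
have N1 g : \forall x \near a, ~ T g -> ~ (\forall z \near x, phi z = gact g z).
  have [Tg|nT] := pselect (T g); first by apply: nearW => x /(_ Tg)[].
  have [E|nE] := pselect (phi a = gact g a).
    have nJ : jacobian (chart_rep phi c d) (c a) <>
        jacobian (chart_rep (gact g : M -> M) c d) (c a).
      by move=> J; apply: nT; split; [exact: E|exact: J].
    by apply: filterS (jacobian_neq_near spa (sga _ E) nJ) => x Hx _; exact: Hx.
  have := hausdorff_neq_near (@mspace_hausdorff _ _ M) (smooth_at_continuous sp)
    (@gact_cont _ _ _ _ g a) nE.
  apply: (@filterS _ (nbhs a)) => x ne _ /nbhs_singleton E; exact: ne.
have N2 g h : \forall x \near a, T g -> T h -> gact g x = gact h x.
  have [Tg|nTg] := pselect (T g); last by apply: nearW => x /nTg[].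
  have [Th|nTh] := pselect (T h); last by apply: nearW => x _ /nTh[].
  have [Eg Jg] := Tg; have [Eh Jh] := Th.
  have fix_a : gact (g^-1 * h)%g a = a by rewrite gactM -Eh Eg gactK.
  have [sid _] := smooth_at_id a.
  have sida := smooth_at_in sid Ac Ac ca ca.
  have ca' : cdom c (gact g^-1%g (gact g a)) by rewrite gactK; exact: ca.
  have da' : cdom d (gact g a) by rewrite -Eg; exact: da.
  have sV := smooth_at_in (gact_smooth_at g^-1 (gact g a)) Ad Ac da' ca'.
  have sV' : smooth_in (gact g^-1%g : M -> M) (gact h a) d c by rewrite -Eh Eg; exact: sV.
  have [s1 E1] := smooth_in_comp (sga _ Eg) sV.
  have [s2 E2] := smooth_in_comp (sga _ Eh) sV'.
  have F1 : \forall x \near a, (gact g^-1%g \o gact g : M -> M) x = (id : M -> M) x.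
    by near=> x; rewrite /= gactK.
  have F2 : \forall x \near a,
      (gact g^-1%g \o gact h : M -> M) x = (gact (g^-1 * h)%g \o id : M -> M) x.
    by near=> x; rewrite /= gactM.
  have J : jacobian (chart_rep (gact (g^-1 * h)%g \o id : M -> M) c c) (c a) =
           jacobian (chart_rep (id : M -> M) c c) (c a).
    apply: (etrans (jacobian_near_eq s2 F2)); apply: esym.
    apply: (etrans (jacobian_near_eq s1 F1)).
    apply: (etrans E1); apply: esym; apply: (etrans E2).
    apply: (etrans (congr1 (mulmx^~ _) (etrans (esym Jh) Jg))).
    exact: (congr1 (fun z => jacobian (chart_rep (gact g : M -> M) c d) (c a) *m
       jacobian (chart_rep (gact g^-1%g : M -> M) d c) (d z)) (etrans (esym Eh) Eg)).
  have := fixed_near_of_derivative (smooth_embedding_id M)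
    (fun s => ex_intro _ (gact (g^-1 * h)%g s) erefl) sida fix_a J.
  by apply: filterS => x; rewrite gactM => /(congr1 (gact g)); rewrite gactVK.
have N3 := nbhs_forall N1.
have N4 := nbhs_forall (fun g => nbhs_forall (N2 g)).
pose Q (x : M) : Prop := [/\ exists g, phi x = gact g x, smooth_at phi x,
   forall g, ~ T g -> ~ (\forall z \near x, phi z = gact g z) &
   forall g h, T g -> T h -> gact g x = gact h x].
have : nbhs a Q.
  have N5 := nbhs_setI (nbhs_setI H (smooth_at_near sp)) (nbhs_setI N3 N4).
  apply: (@filterS M (nbhs a) (nbhs_filter a) _ Q _ N5) => x [[H1 H2] [H3 H4]].
  by split; [exact: H1|exact: H2|exact: H3|exact: H4].
rewrite nbhsE => -[V [oV Va] HV].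
(* A Baire argument for finitely many closed sets: if no element of [T] agrees with [phi] anywhere
   in [O], then [O] can be shrunk once per group element to a nonempty open set where [phi] agrees
   with none. *)
have dense O : open O -> O !=set0 -> O `<=` V -> exists2 x, O x & exists2 g, T g & phi x = gact g x.
  move=> oO O0 OV; apply: contrapT => nE.
  have nT x g : O x -> phi x = gact g x -> ~ T g.
    by move=> Ox E Tg; apply: nE; exists x => //; exists g.
  have step (l : seq G) : exists Z', [/\ open Z', Z' !=set0, Z' `<=` O &
      forall x g, Z' x -> g \in l -> phi x <> gact g x].
    elim: l => [|g l [Z' [oZ' Z'0 Z'O HZ']]].
      by exists O; split; [exact: oO|exact: O0|by []|by move=> x g _; rewrite in_nil].
    have [x Z'x ne] : exists2 x, Z' x & phi x <> gact g x.
      apply: contrapT => ne'.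
      have E x : Z' x -> phi x = gact g x.
        by move=> Z'x; apply: contrapT => ne; apply: ne'; exists x.
      have [x Z'x] := Z'0.
      have [_ _ /(_ g) HV' _] := HV _ (OV _ (Z'O _ Z'x)).
      apply: HV'; first exact: nT (Z'O _ Z'x) (E _ Z'x).
      by apply: filterS (open_nbhs_nbhs (conj oZ' Z'x)) => z /E.
    have [_ sx _ _] := HV _ (OV _ (Z'O _ Z'x)).
    have := hausdorff_neq_near (@mspace_hausdorff _ _ M) (smooth_at_continuous sx)
      (@gact_cont _ _ _ _ g x) ne.
    rewrite /prop_near1 nbhsE => -[B [oB Bx] BH].
    exists (Z' `&` B); split.
    - exact: openI.
    - by exists x.
    - by move=> z [/Z'O].
    - move=> z h [Z'z Bz]; rewrite in_cons => /predU1P[->|hl]; first exact: BH.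
      exact: HZ'.
  have [Z' [_ [x Z'x] Z'O HZ']] := step (enum [set: G]).
  have [[g E] _ _ _] := HV _ (OV _ (Z'O _ Z'x)).
  by apply: (HZ' x g Z'x) E; rewrite mem_enum inE.
have [x Vx [g Tg _]] : exists2 x, V x & exists2 g, T g & phi x = gact g x.
  by apply: dense => //; exists a.
exists g; apply: filterS (open_nbhs_nbhs (conj oV Va)) => y Vy.
apply: contrapT => ne.
have [_ sy _ _] := HV _ Vy.
have := hausdorff_neq_near (@mspace_hausdorff _ _ M) (smooth_at_continuous sy)
  (@gact_cont _ _ _ _ g y) ne.
rewrite /prop_near1 nbhsE => -[B [oB By] BH].
have [|z [Vz Bz] [h Th E]] := dense (V `&` B) (openI oV oB) _ (@subIsetl _ _ _); first by exists y.
have [_ _ _ HT] := HV _ Vz.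
by apply: (BH z Bz); rewrite E (HT _ _ Th Tg).
Unshelve. all: by end_near. Qed.

(** Start from a neighbourhood [V] disjoint from its translates by the elements that move [x], make
    it invariant under the stabilizer, and keep the component of [x]. *)
Lemma exists_slice (x : M) (U : set M) : open U -> U x ->
  exists Y, [/\ open Y, Y x, Y `<=` U, connected Y &
    (forall g y, gact g x = x -> Y y -> Y (gact g y)) /\
    (forall g y, Y y -> Y (gact g y) -> gact g x = x)].
Proof.
move=> oU Ux.
have [V [oV Vx VU HV]] : exists V, [/\ open V, V x, V `<=` U &
    forall g y, gact g x <> x -> V y -> ~ V (gact g y)].
  have H g : exists V, [/\ open V, V x & gact g x <> x -> forall y, V y -> ~ V (gact g y)].
    have [E|ne] := pselect (gact g x = x); first by exists setT; split => //; exact: openT.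
    have /eqP ne' := ne.
    have := @mspace_hausdorff _ _ M; rewrite open_hausdorff.
    move=> /(_ _ _ ne')[[A B] /= [gA xB] [oA oB /eqP AB]].
    exists (B `&` (gact g @^-1` A)); split.
    - by apply: openI => //; have /continuousP := @gact_cont _ _ _ M g; apply.
    - by split; exact: set_mem.
    - move=> _ y [_ Agy] [Bgy _]; have : (A `&` B) (gact g y) by split.
      by rewrite AB.
  have /choice[V HV] := H.
  have nV g : nbhs x (V g) by have [oV Vx _] := HV g; exact: open_nbhs_nbhs.
  have := nbhs_forall nV.
  rewrite nbhsE => -[W [oW Wx] WV].
  exists (U `&` W); split=> //; first exact: openI.
  move=> g y ne [_ Wy] [_ Wgy]; have [_ _ /(_ ne)] := HV g.
  by move=> /(_ y (WV _ Wy g)); apply; exact: WV.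
pose V2 := [set y | forall h, gact h x = x -> V (gact h y)].
have oV2 : open V2.
  rewrite openE => y V2y.
  have Hh h : \forall z \near y, gact h x = x -> V (gact h z).
    have [E|ne] := pselect (gact h x = x); last by apply: nearW => z /ne[].
    have := @gact_cont _ _ _ M h y _ (open_nbhs_nbhs (conj oV (V2y _ E))).
    by apply: (@filterS _ (nbhs y)) => z Vz _.
  exact: (nbhs_forall Hh).
have V2x : V2 x by move=> h ->.
have V2V y : V2 y -> V y by move=> /(_ 1%g); rewrite !gact1; apply.
exists (connected_component V2 x); split.
- exact: manifold_component_open.
- exact: connected_component_refl.
- by move=> y /connected_component_sub/V2V/VU.
- exact: component_connected.
split=> [g y gx Yy|g y]; last first.
  move=> /connected_component_sub/V2V Vy /connected_component_sub/V2V Vgy.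
  by apply: contrapT => ne; exact: HV ne Vy Vgy.
(* A stabilizer element fixes [x] and preserves [V2], so the image of the component is a connected
   subset of [V2] through [x]. *)
have sub : gact g @` connected_component V2 x `<=` connected_component V2 x.
  apply: connected_component_max.
  - by exists x; [exact: connected_component_refl|].
  - move=> _ [z /connected_component_sub V2z <-] h hx.
    by rewrite -gactM; apply: V2z; rewrite gactM gx.
  - apply: connected_continuous_connected; first exact: component_connected.
    exact/continuous_subspaceT/gact_cont.
by apply: sub; exists y.
Qed.

End GMan2.

(** * Orbifold charts *)

Local Open Scope quotient_scope.

Lemma connected_embedding (S T : topologicalType) (i : S -> T) :
  topological_embedding i -> connected (range i) -> connected [set: S].
Proof.
move=> [inj_i _ emb_i] cY B [b Bb] [C1 oC1 BC1] [C2 cC2 BC2].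
move: BC1 BC2; rewrite !setTI => BC1 BC2.
have [D1 oD1 DC1] : exists2 D, open D & B = i @^-1` D by apply: emb_i; rewrite BC1.
have [D2 oD2 DC2] : exists2 D, open D & ~` B = i @^-1` D by apply: emb_i; rewrite openC BC2.
have E : i @` B = range i.
  apply: cY.
  - by exists (i b); exists b.
  - exists D1 => //; apply/seteqP; split=> [_ [y By <-]|_ [[y _ <-] D1y]].
      by split; [exists y|move: By; rewrite DC1].
    by exists y => //; rewrite DC1.
  - exists (~` D2); first exact: open_closedC.
    apply/seteqP; split=> [_ [y By <-]|_ [[y _ <-] D2y]].
      by split; [exists y|move=> D2y; have : (~` B) y; [rewrite DC2|exact]].
    exists y => //; apply: contrapT => nB; apply: D2y.
    by have : (~` B) y by []; rewrite DC2.
apply/seteqP; split=> // y _.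
have [z Bz /inj_i <-] : (i @` B) (i y) by rewrite E; exists y.
exact: Bz.
Qed.

Lemma connected_set_type (T : topologicalType) (Y : set T) :
  connected Y -> connected [set: set_type Y].
Proof.
move=> cY; apply: (connected_embedding (@topological_embedding_val _ Y)).
rewrite (_ : range _ = Y)//; apply/seteqP; split=> [_ [y _ <-]|y Yy]; first exact: set_val_in.
by exists (SigSub (mem_set Yy)) => //; rewrite set_valE.
Qed.

Section Quot.
Context {R : realType} {n : nat} {G : finGroupType} {M : gmanifold R n G}.
Local Notation Q := {eq_quot (@gorbit_equiv R n G M)}.

Lemma orbit_piP (x y : M) : \pi_Q x = \pi_Q y :> Q <-> exists g : G, gact g x = y.
Proof.
split.
  move/eqmodP => /asboolP[g _ <-]; by exists g.
by move=> [g <-]; apply/eqmodP/asboolP; exists g => //=; rewrite inE.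
Qed.

Lemma orbit_map_pi (X : Type) (f : M -> X) (x : M) :
  (forall g y, f (gact g y) = f y) -> @orbit_map R n G M X f (\pi_Q x) = f x.
Proof.
move=> fg; rewrite /orbit_map.
have [g E] := (orbit_piP (repr (\pi_Q x)) x).1 (reprK _).
by rewrite -[in RHS]E fg.
Qed.

Lemma orbit_map_embedding (X : topologicalType) (f : M -> X) :
  continuous f -> (forall g y, f (gact g y) = f y) ->
  (forall x y, f x = f y -> exists g : G, gact g x = y) ->
  (forall A, open A -> open (f @` A)) -> topological_embedding (@orbit_map R n G M X f).
Proof.
move=> cf fg ff fo; split.
- move=> p q; rewrite /orbit_map => /ff/orbit_piP.
  by rewrite !reprK.
- apply/continuousP => A oA.
  have -> : @orbit_map R n G M X f @^-1` A = [set q : Q | f (repr q) \in A].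
    by apply/seteqP; split=> q /=; rewrite in_setE.
  rewrite /open /= /quotient_open.
  have -> : \pi_Q @^-1` [set q : Q | f (repr q) \in A] = f @^-1` A.
    apply/seteqP; split=> x /=; rewrite in_setE -/(orbit_map f (\pi_Q x)) orbit_map_pi//.
  by have /continuousP := cf; apply.
- move=> A oA; exists (f @` (\pi_Q @^-1` A)).
    by apply: fo; exact: oA.
  apply/seteqP; split=> q.
    by move=> Aq; exists (repr q) => //; rewrite /preimage /mkset reprK.
  move=> [x Ax] /ff/orbit_piP; rewrite reprK => <-; exact: Ax.
Qed.

End Quot.

Section Orbichart.
Context {R : realType} {n : nat} {X : topologicalType} (c : orbichart R n X).
Local Notation Q := {eq_quot (@gorbit_equiv R n (ogroup c) (ocover c))}.

Lemma oproj_fiber (x y : ocover c) : c x = c y -> exists g : ogroup c, gact g x = y.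
Proof.
move=> cxy; apply/orbit_piP; have [inj _ _] := oproj_homeo c; apply: inj.
by rewrite !orbit_map_pi//; exact: oproj_invariant.
Qed.

Lemma oproj_open (A : set (ocover c)) : open A -> open (c @` A).
Proof.
move=> oA.
(* The saturation of [A]: it has the same image and descends to an open set of the orbit space. *)
pose A' : set (ocover c) := \bigcup_(g in [set: ogroup c]) (gact g @^-1` A).
have oA' : open A'.
  apply: bigcup_open => g _; by have /continuousP := @gact_cont _ _ _ (ocover c) g; apply.
have [_ _ emb] := oproj_homeo c.
pose B : set (orbit_space (ocover c)) := [set q | A' (repr (q : Q))].
have inv (x y : ocover c) : (exists g : ogroup c, gact g x = y) -> A' x -> A' y.
  move=> [g <-] [h _ Ah]; exists (h * g^-1)%g => //.
  by rewrite /preimage /mkset gactM gactK.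
have oB : open B.
  rewrite /open /= /quotient_open.
  have -> // : \pi_Q @^-1` B = A'.
  apply/seteqP; split=> x; rewrite /B /preimage /mkset; apply: inv.
    exact/orbit_piP/reprK.
  by apply/orbit_piP; rewrite reprK.
have [C oC BC] := emb _ oB.
have -> : c @` A = odom c `&` C.
  rewrite -oproj_range; apply/seteqP; split=> [_ [x Ax <-]|_ [[x _ <-] Cx]].
    split; first by exists x.
    have : B (\pi_Q x).
      apply: (inv x); last by exists 1%g => //; rewrite /preimage /mkset gact1.
      by apply/orbit_piP; rewrite reprK.
    by rewrite BC /preimage /mkset orbit_map_pi//; exact: oproj_invariant.
  have : B (\pi_Q x) by rewrite BC /preimage /mkset orbit_map_pi//; exact: oproj_invariant.
  move=> [g _ Ag]; exists (gact g (repr (\pi_Q x))) => //.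
  rewrite oproj_invariant.
  have [h E] := (orbit_piP (repr (\pi_Q x)) x).1 (reprK _).
  by rewrite -[in RHS]E oproj_invariant.
by apply: openI => //; exact: odom_open.
Qed.

Lemma oproj_in (x : ocover c) : odom c (c x).
Proof. by rewrite -oproj_range; exists x. Qed.

Lemma oproj_surj p : odom c p -> exists x, c x = p.
Proof. by rewrite -oproj_range => -[x _ <-]; exists x. Qed.

End Orbichart.

(** * Restriction of an orbifold chart to a slice *)

Section Restriction.
Context {R : realType} {n : nat}.

Section Slice.
Context {G : finGroupType} {M : gmanifold R n G}.

Definition is_slice (x : M) (Y : set M) :=
  [/\ open Y, Y x, connected Y, (forall (g : G) y, gact g x = x -> Y y -> Y (gact g y)) &
    forall (g : G) y, Y y -> Y (gact g y) -> gact g x = x].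

Definition stab_set (x : M) : {set G} := [set g | gact g x == x]%SET.

Lemma stab_group_set x : group_set (stab_set x).
Proof.
apply/group_setP; split=> [|g h]; first by rewrite inE gact1.
by rewrite !inE gactM => /eqP gx /eqP hx; rewrite hx gx.
Qed.

Definition stab (x : M) : {group G} := Group (stab_group_set x).

Lemma stabP (x : M) (g : G) : reflect (gact g x = x) (g \in stab x).
Proof. by rewrite inE; exact: eqP. Qed.

Variables (x : M) (Y : set M) (sY : is_slice x Y).

Let oY : open Y. Proof. by case: sY. Qed.

(** A chart carries a group type, whence [subg_of]. The default of [insubd] never occurs, since the
    stabilizer preserves the slice. *)
Definition slice_act (u : subg_of (stab x)) (y : opensub oY) : opensub oY :=
  insubd y (gact (sgval u) (set_val y)).

Lemma slice_act_val u y : set_val (slice_act u y) = gact (sgval u) (set_val y).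
Proof.
rewrite val_insubd_set//; have [_ _ _ H _] := sY; apply: H; last exact: set_val_in.
by apply/stabP; exact: subgP.
Qed.

Lemma slice_act1 y : slice_act 1%g y = y.
Proof. by apply: set_val_inj; rewrite slice_act_val gact1. Qed.

Lemma slice_actM u v y : slice_act (u * v)%g y = slice_act u (slice_act v y).
Proof. by apply: set_val_inj; rewrite !slice_act_val -gactM. Qed.

Lemma slice_act_smooth u : smooth_map (slice_act u).
Proof.
apply/smooth_mapP => y.
have E : (set_val \o slice_act u : opensub oY -> M) = gact (sgval u) \o set_val.
  by apply/funext => z; rewrite /= slice_act_val.
have [|] := @smooth_at_lift R n n (opensub oY) M Y oY (slice_act u) y; last by [].
rewrite E; apply: smooth_at_comp; last exact: gact_smooth_at.
by have [] := smooth_at_val y.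
Qed.

Definition slice_gmanifold : gmanifold R n (subg_of (stab x)) :=
  GManifold slice_act1 slice_actM slice_act_smooth.

End Slice.

Context {X : topologicalType} (c : orbichart R n X) (x : ocover c) (Y : set (ocover c)).
Hypothesis sY : is_slice x Y.

Let oY : open Y. Proof. by case: sY. Qed.
Let Yx : Y x. Proof. by case: sY. Qed.

Definition rcover := slice_gmanifold sY.
Definition rproj (y : rcover) : X := c (set_val y).

Lemma rcover_connected : connected [set: rcover].
Proof. by apply: connected_set_type; case: sY. Qed.

(** An element acting trivially on the open slice acts trivially on the whole connected cover, by
    [fixed_of_open]. *)
Lemma rcover_effective : effective_on [set: subg_of (stab x)] [set: rcover].
Proof.
move=> u _ H; apply: subg_inj; rewrite -[RHS]/(1%g : ogroup c).
apply: (@ocover_effective _ _ _ c (sgval u)); first by rewrite inE.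
move=> y _.
apply: (@fixed_of_open R n _ (ocover c) n (ocover c) id (sgval u) Y).
- exact: smooth_embedding_id.
- by move=> s; exists (gact (sgval u) s).
- exact: ocover_connected.
- exact: oY.
- by exists x; exact: Yx.
- move=> s Ys; have := H (SigSub (mem_set Ys)) I.
  by move=> /(congr1 set_val); rewrite /= slice_act_val set_valE.
Qed.

Lemma rproj_continuous : continuous rproj.
Proof.
move=> y; apply: (@continuous_comp _ _ _ (set_val : rcover -> ocover c) c).
  exact: set_val_continuous.
exact: oproj_continuous.
Qed.

Lemma rproj_invariant (g : subg_of (stab x)) y : rproj (gact g y) = rproj y.
Proof. by rewrite /rproj /= slice_act_val oproj_invariant. Qed.

Lemma rproj_range : range rproj = c @` Y.
Proof.
apply/seteqP; split=> [_ [y _ <-]|_ [y Yy <-]].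
  by exists (set_val y) => //; exact: set_val_in.
by exists (SigSub (mem_set Yy)) => //; rewrite /rproj set_valE.
Qed.

(** Injectivity is the second slice property: a group element relating two points of the slice
    stabilizes [x]. *)
Lemma rproj_homeo : topological_embedding (orbit_map rproj).
Proof.
apply: orbit_map_embedding.
- exact: rproj_continuous.
- exact: rproj_invariant.
- move=> y z /oproj_fiber[g gy].
  have gx : g \in stab x.
    apply/stabP; have [_ _ _ _ H] := sY; apply: (H g (set_val y)); first exact: set_val_in.
    by rewrite gy; exact: set_val_in.
  exists (subg (stab x) g); apply: set_val_inj.
  by rewrite /= slice_act_val subgK.
- move=> A [B oB AB].
  have -> : rproj @` A = c @` (B `&` Y).
    apply/seteqP; split=> [_ [y Ay <-]|_ [y [By Yy] <-]].
      exists (set_val y) => //; split; last exact: set_val_in.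
      by move: Ay; rewrite -AB.
    exists (SigSub (mem_set Yy)); last by rewrite /rproj set_valE.
    by rewrite -AB /preimage /mkset set_valE.
  by apply: oproj_open; exact: openI.
Qed.

Definition restr_orbichart : orbichart R n X :=
  @OrbiChart R n X (c @` Y) (subg_of (stab x)) rcover rproj
    (oproj_open oY) rcover_connected rcover_effective rproj_continuous rproj_invariant
    rproj_range rproj_homeo.

End Restriction.

Section AtlasRestriction.
Context {R : realType} {n : nat}.

Lemma exists_is_slice {G : finGroupType} {M : gmanifold R n G} (x : M) (U : set M) :
  open U -> U x -> exists2 Y, is_slice x Y & Y `<=` U.
Proof. by move=> oU /(exists_slice oU)[Y [oY Yx YU cY [H1 H2]]]; exists Y. Qed.

Context {X : topologicalType}.
Implicit Types b c d e : orbichart R n X.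

Lemma injection_gact b c (l : ocover b -> ocover c) (g : ogroup c) :
  injection l -> injection (gact g \o l : ocover b -> ocover c).
Proof.
move=> [bc sl cl]; split=> //.
  exact: smooth_embedding_comp (smooth_embedding_gact g).
by move=> x; rewrite /= oproj_invariant cl.
Qed.

(** The points over [p] form one orbit, so composing [l] with a group element makes it pass through
    the prescribed [u]. *)
Lemma injection_through b c (l : ocover b -> ocover c) p (u : ocover c) :
  injection l -> odom b p -> c u = p ->
  exists w (k : ocover b -> ocover c), [/\ injection k, b w = p & k w = u].
Proof.
move=> il bp cu; have [w bw] := oproj_surj bp.
have [_ _ cl] := il.
have [g gE] : exists g : ogroup c, gact g (l w) = u by apply: oproj_fiber; rewrite cl bw.
by exists w, (gact g \o l); split=> //; exact: injection_gact.
Qed.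

Lemma compatible_in_sym c d p : compatible_in c d p -> compatible_in d c p.
Proof. by move=> [b [bp bcd ic id]]; exists b; split=> //; rewrite setIC. Qed.

Lemma compatible_in_refl c p : odom c p -> compatible_in c c p.
Proof.
move=> cp.
have i : injection (id : ocover c -> ocover c) by split=> //; exact: smooth_embedding_id.
by exists c; split; [|rewrite setIid|exists id|exists id].
Qed.

Lemma compatible_in_restr c e p x (Y : set (ocover c)) (sY : is_slice x Y) :
  compatible_in c e p -> (c @` Y) p -> compatible_in (restr_orbichart sY) e p.
Proof.
move=> [b [bp bce [l il] [l2 il2]]] [u Yu cu].
have [w [k [[bc /smooth_embeddingP[Hk [ki kc ke]] ck] bw kw]]] := injection_through il bp cu.
have sk : smooth_embedding k by apply/smooth_embeddingP.
have oY : open Y by case: sY.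
have oN : open (k @^-1` Y) by move/continuousP: (kc); apply.
have Nw : (k @^-1` Y) w by rewrite /preimage /mkset kw.
(* Shrinking the common chart to a slice that [k] maps into [Y] makes it inject into the restricted
   chart. *)
have [Z sZ ZN] := exists_is_slice oN Nw.
exists (restr_orbichart sZ).
have Zw : Z w by case: sZ.
have bY : b @` Z `<=` c @` Y.
  by move=> _ [z Zz <-]; exists (k z); [exact: ZN|].
have be : b @` Z `<=` odom e.
  by move=> _ [z Zz <-]; have [] := bce _ (oproj_in z).
split.
- by exists w.
- by move=> q Zq; split; [exact: bY|exact: be].
- pose u' : ocover (restr_orbichart sY) := SigSub (mem_set Yu).
  pose j (z : ocover (restr_orbichart sZ)) : ocover (restr_orbichart sY) :=
    insubd u' (k (set_val z)).
  have jE z : set_val (j z) = k (set_val z).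
    by rewrite val_insubd_set//; apply: ZN; exact: set_val_in.
  exists j; split=> //.
    apply: smooth_embedding_lift.
    rewrite (_ : set_val \o j = k \o set_val); last by apply/funext => z; exact: jE.
    exact: smooth_embedding_comp (smooth_embedding_val _) sk.
  by move=> z; rewrite /= /rproj jE ck.
- have [_ sl2 el2] := il2.
  exists (l2 \o set_val); split=> //.
    exact: smooth_embedding_comp (smooth_embedding_val _) sl2.
  by move=> z; rewrite /= el2.
Qed.

End AtlasRestriction.

(** The restriction is compatible with whatever [c] is compatible with, so adding it to the maximal
    atlas still gives an atlas. *)
Lemma restr_in_atlas (R : realType) (n : nat) (O : orbifold R n) (c : orbichart R n O)
    (x : ocover c) (Y : set (ocover c)) (sY : is_slice x Y) :
  oatlas c -> oatlas (restr_orbichart sY).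
Proof.
move=> Ac; have [[cov comp] max] := @oatlas_maximal _ _ O.
have sub p : (c @` Y) p -> odom c p by move=> [y _ <-]; exact: oproj_in.
apply: (max (fun e => oatlas e \/ e = restr_orbichart sY)); last by right.
  split.
    by move=> p; have [e Ae ep] := cov p; exists e => //; left.
  move=> d e [Ad|->] [Ae|->] p dp ep.
  - exact: comp.
  - by apply: compatible_in_sym; apply: compatible_in_restr => //; apply: comp => //; exact: sub.
  - by apply: compatible_in_restr => //; apply: comp => //; exact: sub.
  - exact: compatible_in_refl.
by move=> d Ad; left.
Qed.

(** * Transition maps between orbifold charts *)

Section Transition.
Context {R : realType}.

Lemma local_diffeo_inverse n (M N : manifold R n) (f : M -> N) (x : M) :
  smooth_at f x -> has_rank f x n ->
  exists V (g : N -> M), [/\ open V, V x, forall y, V y -> g (f y) = y, open (f @` V) &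
    forall y, V y -> smooth_at g (f y) /\ has_rank g (f y) n].
Proof.
move=> sf rf; have [V [oV Vx sV inj [oF H]]] := local_diffeo sf rf.
pose g z := xget x [set y | V y /\ f y = z].
have gf y : V y -> g (f y) = y.
  move=> Vy; have [Vg fg] : [set y' | V y' /\ f y' = f y] (g (f y)).
    by apply: xgetPex; exists y.
  exact: inj.
by exists V, g; split => //; exact: H.
Qed.

Lemma diffeo_image_open n (M N : manifold R n) (f : M -> N) (V B : set M) (g : N -> M) :
  open (f @` V) -> (forall y, V y -> g (f y) = y) -> (forall y, V y -> smooth_at g (f y)) ->
  open B -> B `<=` V -> open (f @` B).
Proof.
move=> oV gf sg oB BV.
have -> : f @` B = (f @` V) `&` g @^-1` B.
  apply/seteqP; split=> [_ [y By <-]|_ [[y Vy <-]]].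
    by have Vy := BV _ By; split; [exists y|rewrite /preimage /mkset gf].
  by rewrite /preimage /mkset gf// => By; exists y.
apply: openI_preimage => // _ [y Vy <-].
exact: smooth_at_continuous (sg _ Vy).
Qed.

(** A common chart [b] injects into [c] through [v] by [k] and into [c'] through [v'] by [mu]; [t]
    is [mu] after a local inverse of [k]. *)
Lemma exists_transition n (O : orbifold R n) (c c' : orbichart R n O)
    (v : ocover c) (v' : ocover c') :
  oatlas c -> oatlas c' -> c v = c' v' ->
  exists (t : ocover c -> ocover c') (A : set (ocover c)),
  [/\ open A, A v /\ t v = v',
      forall y, A y -> smooth_at t y /\ has_rank t y n /\ c' (t y) = c y,
      forall B, open B -> B `<=` A -> open (t @` B) &
      forall g : ogroup c, gact g v = v ->
        exists g' : ogroup c', \forall y \near v, t (gact g y) = gact g' (t y)].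
Proof.
move=> Ac Ac' cv.
have [[_ comp] _] := @oatlas_maximal _ _ O.
have cp : odom c (c v) by exact: oproj_in.
have cp' : odom c' (c v) by rewrite cv; exact: oproj_in.
have [b [bp _ [l il] [m im]]] := comp _ _ Ac Ac' _ cp cp'.
have [w [k [ik bw kw]]] := injection_through il bp (erefl (c v)).
have [g0 mw] : exists g : ogroup c', gact g (m w) = v'.
  by apply: oproj_fiber; have [_ _ ->] := im; rewrite bw.
have [_ /smooth_embeddingP[Hk [injk kc _]] ck] := ik.
have [_ /smooth_embeddingP[Hm [injm _ _]] cm] := injection_gact g0 im.
set mu := (gact g0 \o m) in Hm injm cm.
have muw : mu w = v' by [].
have [Vk [ki [oVk Vkw kiE oKV ski]]] := local_diffeo_inverse (Hk w).1 (Hk w).2.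
have [Vm [mi [oVm Vmw miE oMV smi]]] := local_diffeo_inverse (Hm w).1 (Hm w).2.
pose V := Vk `&` Vm.
have oV : open V by exact: openI.
have Vw : V w by [].
pose A := k @` V.
have oA : open A.
  by apply: (diffeo_image_open oKV kiE) => //; [move=> y /ski[]|exact: subIsetl].
pose t := mu \o ki.
have AE y : A y -> [/\ V (ki y), k (ki y) = y & smooth_at ki y /\ has_rank ki y n].
  move=> [a [Vka Vma] <-]; rewrite kiE//.
  by split=> //; exact: ski.
have At y : A y -> smooth_at t y /\ has_rank t y n /\ c' (t y) = c y.
  move=> Ay; have [Vy ky [sy ry]] := AE _ Ay.
  split; first by apply: smooth_at_comp => //; exact: (Hm _).1.
  split; first by apply: immersion_comp => //; [exact: (Hm _).1|exact: (Hm _).2].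
  by rewrite /t /= cm -ck ky.
have Av : A v by rewrite -kw; exists w.
have kiv : ki v = w by rewrite -kw kiE.
have tv : t v = v' by rewrite /t /= kiv.
exists t, A; split => //.
  move=> B oB BA.
  have -> : t @` B = mu @` (V `&` k @^-1` B).
    apply/seteqP; split=> [_ [y By <-]|_ [a [Va Ba] <-]].
      have [Vy ky _] := AE _ (BA _ By).
      by exists (ki y) => //; split=> //; rewrite /preimage /mkset ky.
    by exists (k a) => //; rewrite /t /= kiE//; case: Va.
  apply: (diffeo_image_open oMV miE).
  - by move=> y /smi[].
  - by apply: openI => //; move/continuousP: kc; apply.
  - by move=> y [[_]].
move=> g gv.
(* Near [v'] this is [g] conjugated by [t]. It covers the identity of the orbifold, so pointwise it
   is a group element by [oproj_fiber], and [locally_group_element] makes that element uniform. *)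
pose phi := t \o gact g \o k \o mi.
have miv : mi v' = w by rewrite -muw miE.
have sphi : smooth_at phi v'.
  have s1 : smooth_at mi v' by rewrite -muw; have [] := smi _ Vmw.
  have s2 : smooth_at (k \o mi) v'.
    by apply: smooth_at_comp s1 _; rewrite miv; exact: (Hk w).1.
  have E2 : (k \o mi) v' = v by rewrite /= miv kw.
  have s3 : smooth_at (gact g \o (k \o mi)) v'.
    by apply: smooth_at_comp s2 _; exact: gact_smooth_at.
  apply: (smooth_at_comp s3); rewrite /= miv kw gv.
  by have [] := At _ Av.
have N1 : \forall y \near v, A y /\ A (gact g y).
  apply: nbhs_setI; first exact: open_nbhs_nbhs.
  by apply: gact_cont; rewrite gv; exact: open_nbhs_nbhs.
have N2 : \forall a \near v', exists g' : ogroup c', phi a = gact g' a.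
  have c1 : {for v', continuous (k \o mi)}.
    apply: continuous_comp; last exact: kc.
    by rewrite -muw; apply: smooth_at_continuous; have [] := smi _ Vmw.
  have N3 : nbhs v' (fun a => (mu @` V) a).
    apply: open_nbhs_nbhs; split; last by exists w.
    by apply: (diffeo_image_open oMV miE) => //; [move=> y /smi[]|exact: subIsetr].
  have N4 : nbhs v' (fun a => A (k (mi a)) /\ A (gact g (k (mi a)))).
    by apply: (c1 (fun y => A y /\ A (gact g y))); rewrite /= miv kw; exact: N1.
  apply: (filterS _ (nbhs_setI N3 N4)) => a [[y [Vky Vmy] <-]]; rewrite /phi /= miE// => -[_ Agy].
  have [g' E] : exists g' : ogroup c', gact g' (mu y) = t (gact g (k y)).
    apply: oproj_fiber; have [_ [_ ->]] := At _ Agy.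
    by rewrite oproj_invariant ck cm.
  by exists g'.
have [g' Hg'] := locally_group_element sphi N2.
exists g'.
have ct : {for v, continuous t} by apply: smooth_at_continuous; have [] := At _ Av.
have N5 : nbhs v (fun y => phi (t y) = gact g' (t y)).
  by apply: (ct (fun a => phi a = gact g' a)); rewrite tv; exact: Hg'.
have N6 : nbhs v A by exact: open_nbhs_nbhs.
apply: (filterS _ (nbhs_setI N5 N6)) => y [<- Ay].
have [[Vky Vmy] ky _] := AE _ Ay.
by rewrite /phi /t /= miE// ky.
Qed.

End Transition.

(** Shows that a small piece of [V] still has an image open in the image of [V]. Far sheets of [V]
    over points near [c v] are the danger: closedness excludes those not passing over [c v], and the
    subgroup moves the others into [N]. *)
Lemma closed_Hsubset_local_open (R : realType) (n : nat) (X : topologicalType) (c : orbichart R n X)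
    (D : {group ogroup c}) (V N : set (ocover c)) (v : ocover c) :
  (forall x, V x -> V `&` gorbit [set: ogroup c] x = gorbit D x) -> closed V -> V v ->
  open N -> N v ->
  exists2 W : set X, open W /\ W (c v) & (c @` V) `&` W `<=` c @` (N `&` V).
Proof.
move=> HV cV Vv oN Nv.
have H (g : ogroup c) : \forall y \near v, V (gact g y) -> (c @` (N `&` V)) (c y).
  have [Vgv|nV] := pselect (V (gact g v)); last first.
    have oC : open (~` V) by exact: closed_openC.
    have := @gact_cont _ _ _ (ocover c) g v _ (open_nbhs_nbhs (conj oC nV)).
    by apply: (@filterS _ (nbhs v)) => y /= nVy Vy.
  have [h hD hE] : gorbit D v (gact g v).
    by rewrite -HV//; split=> //; exists g => //=; rewrite inE.
  (* As [g] and [h] agree at [v], correcting [g] by the inverse of [h] brings nearby points back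
     into [N]; since [h] is in [D], it does not leave [V]. *)
  have hN : N (gact (h^-1 * g)%g v) by rewrite gactM -hE gactK.
  have := @gact_cont _ _ _ (ocover c) (h^-1 * g)%g v _ (open_nbhs_nbhs (conj oN hN)).
  apply: (@filterS _ (nbhs v)) => y /= Ny Vgy.
  exists (gact (h^-1 * g)%g y); last by rewrite oproj_invariant.
  split=> //.
  have : gorbit D (gact g y) (gact (h^-1 * g)%g y).
    by exists h^-1%g; rewrite ?gactM//= groupV.
  by rewrite -HV// => -[].
have := nbhs_forall H; rewrite nbhsE => -[B [oB Bv] BH].
exists (c @` B); first by split; [exact: oproj_open|exists v].
move=> _ [[u Vu <-] [y By yu]].
have [g gE] := oproj_fiber yu.
by rewrite -yu; apply: (BH _ By g); rewrite gE.
Qed.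

(** * Images of suborbifolds *)

(** Applied to three open sets [B]: the interior of [K], the complement of [V], and an open set
    whose image is to be shown relatively open. *)
Lemma compact_setD_image_closed (S T : topologicalType) (f : S -> T) (K B : set S) :
  hausdorff_space T -> compact K -> open B -> (forall y, K y -> {for y, continuous f}) ->
  closed (f @` (K `&` ~` B)).
Proof.
move=> hT cK oB cf; apply: compact_closed => //.
apply: continuous_compact.
  by apply: continuous_in_subspaceT => y; rewrite inE => -[Ky _]; exact: cf.
by apply: compact_closedI => //; exact: open_closedC.
Qed.

Lemma invariant_compact_nbhs (R : realType) (n : nat) (G : finGroupType) (M : gmanifold R n G)
    (x : M) (U : set M) : open U -> U x ->
  exists K, [/\ compact K, nbhs x K, K `<=` U &
    forall g y, gact g x = x -> K y -> K (gact g y)].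
Proof.
move=> oU Ux; have [K0 [cK0 nK0 K0U]] := manifold_locally_compact oU Ux.
have clK0 : closed K0 by apply: compact_closed cK0; exact: mspace_hausdorff.
pose K := [set y : M | forall g : G, gact g x = x -> K0 (gact g y)].
have KK0 : K `<=` K0 by move=> y /(_ 1%g); rewrite !gact1; apply.
exists K; split.
- apply: subclosed_compact cK0 KK0.
  have -> : K = \bigcap_(g in [set g : G | gact g x = x]) (gact g @^-1` K0) by [].
  apply: closed_bigI => g _; apply: preimage_closed => // y _; exact: gact_cont.
- have H (g : G) : \forall y \near x, gact g x = x -> K0 (gact g y).
    have [E|ne] := pselect (gact g x = x); last by apply: nearW => y /ne[].
    have : nbhs (gact g x) K0 by rewrite E.
    by move/(@gact_cont _ _ _ M g x); apply: (@filterS _ (nbhs x)) => y Ky _.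
  exact: nbhs_forall H.
- by move=> y /KK0/K0U.
- by move=> g y gx Ky h hx; rewrite -gactM; apply: Ky; rewrite gactM gx hx.
Qed.

Section Image.
Context {R : realType} {n1 n2 : nat} {O1 : orbifold R n1} {O2 : orbifold R n2}.

Lemma suborbifold_chart_image (f : O1 -> O2) (k : nat) (P : set O1) (p : O1)
    (c : orbichart R n1 O1) (D : {group ogroup c}) (V : set (ocover c)) :
  orbi_embedding f -> suborbifold_chart k P p D V ->
  exists (d : orbichart R n2 O2) (D' : {group ogroup d}) V',
    suborbifold_chart k (f @` P) (f p) D' V' /\ (effective_on D V -> effective_on D' V').
Proof.
move=> [[n12 _ rkf] [inj_f cont_f emb_f]].
move=> [Ac [[S [i [si rV]]] HV] cV clV [[v Vv cvp] [W1 oW1 cVW1]]].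
have [c1 [d [F [T [[[Ac1 Ad] [c1p dfp] /smooth_mapP sF dF FT] [x c1x rF]]]]]] := rkf p.
have cx : c v = c1 x by rewrite cvp c1x.
have [t [A [oA [Av tv] At tO tg]]] := exists_transition Ac Ac1 cx.
have /smooth_embeddingP[Hi [inj_i cont_i emb_i]] := si.
have Vi s : V (i s) by rewrite -rV; exists s.
have VD g y : g \in D -> V y -> V (gact g y).
  move=> gD Vy; have : gorbit D y (gact g y) by exists g.
  by rewrite -HV// => -[].
have VDE y g : V y -> V (gact g y) -> exists2 h, h \in D & gact h y = gact g y.
  move=> Vy Vgy; have [h hD hE] : gorbit D y (gact g y).
    by rewrite -HV//; split=> //; exists g => //=; rewrite inE.
  by exists h.
pose s0 := F \o t.
have ss0 : smooth_at s0 v by apply: smooth_at_comp; [have [] := At _ Av|exact: sF].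
have rs0 : has_rank s0 v n1.
  have [st [rt _]] := At _ Av.
  by apply: immersion_comp st _ rt _; [exact: sF|rewrite tv].
have [B [oB Bv sB injB]] := immersion_near ss0 rs0.
have ds y : A y -> d (s0 y) = f (c y).
  by move=> Ay; rewrite /s0 /= -dF; have [_ [_ ->]] := At _ Ay.
pose near_eqv (g : ogroup c) (h : ogroup c1) : Prop :=
  \forall y \near v, gact g v = v -> t (gact g y) = gact h (t y).
(* [h0] transports the stabilizer of [v] to the chart of the lift; its value 1 on other elements is
   a placeholder. *)
have /choice[h0 hN] : forall g, exists h, near_eqv g h.
  move=> g; have [E|ne] := pselect (gact g v = v).
    by have [g' Hg'] := tg _ E; exists g'; apply: filterS Hg' => y Hy _.
  by exists 1%g; apply: nearW => y /ne[].
have := nbhs_forall hN; rewrite nbhsE => -[U0 [oU0 U0v] U0h].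
have oU1 : open (A `&` (B `&` U0)) by do 2 apply: openI => //.
(* [K] is taken inside this slice, so an element carrying a point of [K] into [K] fixes [v]. *)
have [Y1 [oY1 Y1v Y1U _ [_ Y1s]]] := exists_slice oU1 (conj Av (conj Bv U0v)).
have [K [cK nK KY1 KS]] := invariant_compact_nbhs oY1 Y1v.
have KA y : K y -> A y by move=> /KY1/Y1U[].
have KB y : K y -> B y by move=> /KY1/Y1U[_ []].
have Kh y g : K y -> gact g v = v -> t (gact g y) = gact (h0 g) (t y).
  by move=> /KY1/Y1U[_ [_ /U0h]]; apply.
have Kv : K v by exact: nbhs_singleton.
have Kc y : K y -> {for y, continuous s0}.
  by move=> /KB/sB[sy _]; exact: smooth_at_continuous sy.
have Kinj y z : K y -> K z -> s0 y = s0 z -> y = z by move=> /KB Hy /KB Hz; exact: injB.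
have hT2 : hausdorff_space (ocover d) by exact: mspace_hausdorff.
pose z := s0 v.
(* Avoiding [C] ensures ([WK]) that a point of [K] sent into [W] is interior to [K]. *)
pose C := s0 @` (K `&` ~` interior K).
have clC : closed C by apply: compact_setD_image_closed => //; exact: open_interior.
have nCz : (~` C) z by move=> [y [Ky nKy] /(Kinj _ _ Ky Kv) yv]; apply: nKy; rewrite yv.
have [W sW WC] := exists_is_slice (closed_openC clC) nCz.
have [oW Wz _ _ _] := sW.
pose d' := restr_orbichart sW.
have Ad' : oatlas d' by exact: restr_in_atlas.
have WK y : K y -> W (s0 y) -> interior K y.
  by move=> Ky /WC nC; apply: contrapT => nKy; apply: nC; exists y.
(* Asking for [g'], and not only that [u] act on [s0 @` K] as [g] does, makes this group act
   effectively: [u] is not determined by its restriction to the image of [s0], which may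
   have positive codimension. *)
pose rho (u : ogroup d') := exists2 g, g \in D /\ gact g v = v &
  exists2 g' : ogroup c1, sgval u = T g' & forall y, K y -> t (gact g y) = gact g' (t y).
pose D'set : {set ogroup d'} := [set u | `[< rho u >]]%SET.
have D'P u : (u \in D'set) <-> rho u.
  rewrite inE; split; first by move/asboolP.
  by move=> H; apply/asboolP.
have gD' : group_set D'set.
  apply/group_setP; split.
    apply/D'P; exists 1%g; first by rewrite group1 gact1.
    by exists 1%g; [rewrite (morph1 T)|move=> y _; rewrite !gact1].
  move=> u u' /D'P[g [gD gv] [g1 ug gE]] /D'P[g' [gD' g'v] [g1' ug' gE']].
  apply/D'P; exists (g * g')%g; first by rewrite groupM// gactM g'v gv.
  exists (g1 * g1')%g; first by rewrite morphM ?inE//= -ug -ug'.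
  by move=> y Ky; rewrite !gactM gE ?gE'//; exact: KS.
pose D' : {group ogroup d'} := Group gD'.
have D's u g g' : sgval u = T g' -> (forall y, K y -> t (gact g y) = gact g' (t y)) ->
    forall y, K y -> s0 (gact g y) = gact (sgval (u : ogroup d')) (s0 y).
  by move=> uE gE y Ky; rewrite /s0 /= gE// FT uE.
pose val' : ocover d' -> ocover d := set_val.
pose V0 : set (ocover d') := val' @^-1` (s0 @` (K `&` V)).
have clV0 : closed V0.
  have cl : closed (s0 @` (K `&` V)).
    rewrite -[V]setCK; apply: compact_setD_image_closed => //; exact: closed_openC.
  by apply: preimage_closed cl => y _; exact: set_val_continuous.
pose z' : ocover d' := SigSub (mem_set Wz).
have z'E : val' z' = z by rewrite /val' set_valE.
have V0z : V0 z' by exists v; [|rewrite z'E].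
(* [V0] is closed but perhaps disconnected; a component of a closed set is closed. *)
pose V2 := connected_component V0 z'.
have V2V0 : V2 `<=` V0 by exact: connected_component_sub.
have V2z : V2 z' by exact: connected_component_refl.
pose j0 (s : S) : ocover d' := insubd z' (s0 (i s)).
pose Q1 := [set s | interior K (i s) /\ W (s0 (i s))].
have oKi : open (i @^-1` interior K).
  by move/continuousP: cont_i; apply; exact: open_interior.
have intK y : interior K y -> K y by exact: interior_subset.
have cs0i s : interior K (i s) -> {for s, continuous (s0 \o i)}.
  by move=> /intK Ks; apply: continuous_comp; [exact: cont_i|exact: Kc].
have oQ1 : open Q1.
  have -> : Q1 = (i @^-1` interior K) `&` (s0 \o i) @^-1` W by [].
  by apply: openI_preimage.
have j0E s : Q1 s -> val' (j0 s) = s0 (i s).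
  by move=> [_ Ws]; exact: val_insubd_set.
have j0V0 s : Q1 s -> V0 (j0 s).
  by move=> Qs; exists (i s); [split; [exact/intK/Qs.1|exact: Vi]|rewrite j0E].
have j0c s : Q1 s -> {for s, continuous j0}.
  move=> Qs; apply: continuous_into_set_type.
  apply: (@near_eq_continuous _ _ (s0 \o i)); last exact: cs0i Qs.1.
  by apply: filterS (open_nbhs_nbhs (conj oQ1 Qs)) => s' Qs'; rewrite /= -/val' j0E.
pose Q := [set s | Q1 s /\ V2 (j0 s)].
(* A connected neighbourhood in [Q1] of a point of [Q] is mapped into [V0] as a connected set
   meeting [V2], hence into [V2]. *)
have oQ : open Q.
  rewrite openE => s [Qs V2s].
  have [Z [oZ Zs ZQ cZ]] := manifold_locally_connected oQ1 Qs.
  have sub : j0 @` Z `<=` V2.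
    have Zc : connected (j0 @` Z).
      apply: connected_continuous_connected => //.
      by apply: continuous_in_subspaceT => s'; rewrite inE => /ZQ/j0c.
    rewrite /V2 (same_connected_component V2s).
    apply: (@connected_component_max _ V0 (j0 @` Z) (j0 s) _ _ Zc); first by exists s.
    by move=> _ [s' /ZQ Qs' <-]; exact: j0V0.
  apply: filterS (open_nbhs_nbhs (conj oZ Zs)) => s' Zs'.
  by split; [exact: ZQ|apply: sub; exists s'].
have QE a : V2 a -> exists2 s, Q s & j0 s = a.
  move=> V2a; have [y [Ky Vy] yE] := V2V0 _ V2a.
  have [s _ sy] : range i y by rewrite rV.
  (* [V0] only provides a point of [K]; lying over [W] puts it in the interior of [K], so the open
     set [Q] covers all of [V2]. *)
  have Wy : W (s0 y) by rewrite yE; exact: set_val_in.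
  have Q1s : Q1 s by rewrite /Q1 /= sy; split=> //; exact: WK.
  have js : j0 s = a by apply: set_val_inj; rewrite -/val' j0E// sy.
  by exists s => //; split=> //; rewrite js.
pose iQ : opensub oQ -> S := set_val.
have iQQ s : Q (iQ s) by exact: set_val_in.
pose j : opensub oQ -> ocover d' := j0 \o iQ.
have jE s : val' (j s) = s0 (i (iQ s)) by apply: j0E; have [] := iQQ s.
have iQK s : K (i (iQ s)) by have [[/intK]] := iQQ s.
have sj : smooth_embedding j.
  apply: smooth_embedding_lift.
  have -> : (set_val \o j : opensub oQ -> ocover d) = s0 \o (i \o iQ).
    by apply/funext => s; exact: jE.
  have sii : smooth_embedding (i \o iQ) by exact: smooth_embedding_comp (smooth_embedding_val _) si.
  have /smooth_embeddingP[Hii [inj_ii c_ii emb_ii]] := sii.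
  apply/smooth_embeddingP; split.
    move=> s; have [s1 r1] := Hii s; have [s2 r2] := sB _ (KB _ (iQK s)).
    by split; [exact: smooth_at_comp|exact: immersion_comp].
  split.
  - by move=> s s' E; apply: inj_ii; apply: Kinj E; exact: iQK.
  - by move=> s; apply: continuous_comp; [exact: c_ii|apply: Kc; exact: iQK].
  - move=> E /emb_ii[E' oE' ->].
    (* By injectivity of [s0] on [K], avoiding the compact image of the part of [K] outside [E']
       means coming from [E']. *)
    exists (~` (s0 @` (K `&` ~` E'))).
      by apply: closed_openC; apply: compact_setD_image_closed.
    apply/seteqP; split=> s; rewrite /preimage /mkset /=.
      by move=> E's [y [Ky nE'y] /Kinj E0]; apply: nE'y; rewrite E0//; exact: iQK.
    move=> nE; apply: contrapT => nE's; apply: nE.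
    by exists (i (iQ s)) => //; split=> //; exact: iQK.
have rj : range j = V2.
  apply/seteqP; split=> [_ [s _ <-]|a /QE[s Qs <-]]; first by have [] := iQQ s.
  by exists (SigSub (mem_set Qs)) => //; rewrite /j /iQ /= set_valE.
have V2D' u a : u \in D' -> V2 a -> V2 (gact u a).
  move=> /D'P[g [gD gv] [g' ug gE]] V2a.
  have uE := D's u g g' ug gE.
  have valE b : val' (gact u b) = gact (sgval u) (val' b) by exact: slice_act_val.
  have sub : gact u @` V2 `<=` V2.
    apply: (@connected_component_max _ V0 (gact u @` V2) z').
    - exists z' => //; apply: set_val_inj; rewrite -/val' valE z'E.
      by rewrite -(uE _ Kv) gv.
    - move=> _ [b /V2V0[y [Ky Vy] yE] <-]; exists (gact g y).
        by split; [exact: KS|exact: VD].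
      by rewrite valE -yE uE.
    - apply: connected_continuous_connected; first exact: component_connected.
      exact/continuous_subspaceT/gact_cont.
  by apply: sub; exists a.
have dV2 s : K (i s) -> d (s0 (i s)) = f (c (i s)) by move=> /KA; exact: ds.
have chartE : suborbifold_chart k (f @` P) (f p) D' V2.
  split.
  - exact: Ad'.
  - split; first by exists (opensub oQ), j.
    move=> a V2a; apply/seteqP; split=> [a' [V2a' [u _ uE]]|a' [u uD <-]]; last first.
      by split; [exact: V2D'|exists u => //=; rewrite inE].
    have [y [Ky Vy] yE] := V2V0 _ V2a.
    have [y' [Ky' Vy'] yE'] := V2V0 _ V2a'.
    (* Here injectivity of [f] turns a common orbit in the target into a common orbit in the
       source. *)
    have cyy' : c y = c y'.
      apply: inj_f; rewrite -ds; last exact: KA.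
      rewrite -ds; last exact: KA.
      rewrite yE yE' -uE.
      exact: (esym (@oproj_invariant _ _ _ d' u a)).
    have [g gE] := oproj_fiber cyy'.
    (* The orbit condition on [V] trades [g] for an element of [D]. It fixes [v] because [y] and its
       image lie in [Y1], so [h0] can transport it. *)
    have [h hD hE] : exists2 h, h \in D & gact h y = gact g y by apply: VDE => //; rewrite gE.
    have hv : gact h v = v.
      by apply: (Y1s h y); [exact: KY1|rewrite hE gE; exact: KY1].
    have gz : T (h0 h) \in stab z.
      by apply/stabP; rewrite /z /s0 /= -FT -Kh// hv.
    exists (subg (stab z) (T (h0 h)) : ogroup d').
      apply/D'P; exists h => //; exists (h0 h); first by rewrite subgK.
      by move=> y1 Ky1; exact: Kh.
    apply: set_val_inj; rewrite -/val'.
    apply: (etrans (slice_act_val _ _)); rewrite subgK// -/(val' a) -yE -yE' -gE -hE.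
    by rewrite /s0 /= Kh// FT.
  - exact: component_connected.
  - exact: component_closed.
  - split.
      by exists z' => //; rewrite /= /rproj -/val' z'E ds// cvp.
    (* Relative openness is carried through three maps: [emb_i] makes the open set [Q] a trace of
       some [N], [closed_Hsubset_local_open] takes it down to the first orbifold, and [emb_f] on to
       the second. *)
    have loc a : V2 a -> exists2 E : set O2, open E /\ E (d' a) & (f @` P) `&` E `<=` d' @` V2.
      move=> V2a; have [s Qs sa] := QE _ V2a.
      have [N oN QN] := emb_i _ oQ.
      have Ns : N (i s) by move: Qs; rewrite QN.
      have [X [oX Xs] XN] := closed_Hsubset_local_open HV clV (Vi s) oN Ns.
      have oWX : open (W1 `&` X) by exact: openI.
      have [E oE WXE] := emb_f _ oWX.
      have cW1 y : V y -> P (c y) /\ W1 (c y).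
        by move=> Vy; have : (c @` V) (c y) by [exists y]; rewrite cVW1.
      have da : d' a = f (c (i s)).
        by rewrite -sa /= /rproj -/val' j0E ?dV2//; [exact/intK/Qs.1.1|exact: Qs.1].
      exists E; first split=> //.
        have : (W1 `&` X) (c (i s)) by split=> //; have [] := cW1 _ (Vi s).
        by rewrite WXE da.
      move=> _ [[q Pq <-] Efq].
      have [W1q Xq] : (W1 `&` X) q by rewrite WXE.
      have [|y [Ny Vy] yq] := XN q; first by split=> //; rewrite cVW1.
      have [s' _ s'y] : range i y by rewrite rV.
      have Qs' : Q s' by rewrite QN /preimage /mkset s'y.
      exists (j0 s'); first by have [] := Qs'.
      rewrite /= /rproj -/val' j0E; last exact: Qs'.1.
      by rewrite dV2 ?s'y ?yq//; rewrite -s'y; exact/intK/Qs'.1.1.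
    pose Wo := \bigcup_(E in [set E : set O2 | open E /\ (f @` P) `&` E `<=` d' @` V2]) E.
    exists Wo; first by apply: bigcup_open => E [].
    apply/seteqP; split=> [_ [a V2a <-]|q [Pq [E [oE EV] Eq]]]; last by apply: EV.
    split; last by have [E [oE Ea] EV] := loc _ V2a; exists E.
    have [s Qs sa] := QE _ V2a.
    have Pc : P (c (i s)).
      by have : (c @` V) (c (i s)) by [exists (i s)]; rewrite cVW1 => -[].
    exists (c (i s)) => //.
    by rewrite -sa /= /rproj -/val' j0E ?dV2//; [exact/intK/Qs.1.1|exact: Qs.1].
exists d', D', V2; split; first exact: chartE.
move=> effD u uD' uV2.
have /D'P[g [gD gv] [g' ug gE]] := uD'.
have uE := D's u g g' ug gE.
have [s Qs _] := QE _ V2z.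
(* Triviality of [u] on [V2] says that [g] fixes the open piece [Q] of the connected [S], hence all
   of [V]. *)
have gi1 : forall s, gact g (i s) = i s.
  apply: (@fixed_of_open _ _ _ (ocover c) k S i g Q) => //.
  - move=> s1; have : V (gact g (i s1)) by apply: VD.
    by rewrite -rV => -[s2 _ E]; exists s2.
  - apply: (@connected_embedding _ _ i); first by split.
    by rewrite rV.
  - by exists s.
  move=> s1 [Q1s V2s].
  have K1 : K (i s1) by exact/intK/Q1s.1.
  apply: Kinj => //; first exact: KS.
  rewrite uE//.
  have := uV2 _ V2s; move/(congr1 val'); rewrite /val'.
  move=> E; rewrite -(j0E _ Q1s); apply: etrans E; apply: esym; exact: slice_act_val.
have g1 : g = 1%g.
  apply: effD => // y Vy; have [s1 _ <-] : range i y by rewrite rV.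
  exact: gi1.
(* With [g = 1], [g'] fixes the open image of the interior of [K] under [t], so the effective action
   on the cover of [c1] makes it trivial, and [u = T g'] with it. *)
have g'1 : g' = 1%g.
  apply: (@ocover_effective _ _ _ c1); first by rewrite inE.
  move=> y _.
  apply: (@fixed_of_open _ _ _ (ocover c1) n1 (ocover c1) id g' (t @` interior K)).
  - exact: smooth_embedding_id.
  - by move=> y1; exists (gact g' y1).
  - exact: ocover_connected.
  - by apply: tO; [exact: open_interior|move=> y1 /intK/KA].
  - by exists (t v); exists v.
  - by move=> _ [y1 /intK Ky1 <-]; rewrite -gE// g1 gact1.
apply: subg_inj; rewrite -[LHS]/(sgval u) ug g'1 morph1.
by [].
Qed.

End Image.

Theorem proposition3p10 (R : realType) (n1 n2 : nat)
    (O1 : orbifold R n1) (O2 : orbifold R n2) (f : O1 -> O2)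
    (hf : orbi_embedding f) (k : nat) (P : set O1) :
  (suborbifold k P -> suborbifold k (f @` P)) /\
  (embedded_suborbifold k P -> embedded_suborbifold k (f @` P)).
Proof.
have n12 : (n1 <= n2)%N by case: hf => -[].
split=> -[kn H]; split; [exact: leq_trans n12| |exact: leq_trans n12|].
  move=> _ [p Pp <-]; have [c [D [V cDV]]] := H _ Pp.
  by have [d [D' [V' [cDV' _]]]] := suborbifold_chart_image hf cDV; exists d, D', V'.
move=> _ [p Pp <-]; have [c [D [V [cDV eff]]]] := H _ Pp.
have [d [D' [V' [cDV' eff']]]] := suborbifold_chart_image hf cDV.
by exists d, D', V'; split => //; exact: eff'.
Qed.
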